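(* Let $r>0$, let $H\in\mathbb R^{p\times q}$, and let $X\subset\mathbb R^p$, $Y\subset\mathbb R^q$, $F$, $G$, $\psi$, $\phi$ satisfy Assumptions A and B (stated in the context). Then, with the notation and initial conditions of the context, the time-varying dynamics $$\dot z=\frac rt\big[\nabla\pi^*(w)-z\big],\qquad \dot w=\frac tr\Big[-\nabla R(z)-\tilde H\big(z+\tfrac tr\dot z\big)+\nabla\pi\big(z+\tfrac tr\dot z\big)-w\Big],$$ with $z(0)=z_0=\nabla\pi^*(w_0)$ and $w(0)=w_0=\nabla\pi(z_0)$, has a unique solution $(z(t),w(t))$ for all $t\ge 0$.
   Context: Saddle-point problem: $\min_{x\in X}\max_{y\in Y} L(x,y):=F(x)+x^{\rm T}Hy-G(y)$. A pair $(x^\star,y^\star)\in X\times Y$ is a saddle point (solution) if $L(x^\star,y)\le L(x^\star,y^\star)\le L(x,y^\star)$ for all $x\in X$, $y\in Y$. Assumption A: $X\subset\mathbb R^p$ and $Y\subset\mathbb R^q$ are nonempty, closed and convex; $F$ and $G$ are continuously differentiable and strictly convex on open sets containing $X$ and $Y$, respectively; $\nabla F$ and $\nabla G$ are Lipschitz continuous over $X$ and $Y$, respectively; there exists a unique saddle point of the problem. Assumption B: $\psi:\mathbb R^p\to\mathbb R\cup\{\infty\}$ and $\phi:\mathbb R^q\to\mathbb R\cup\{\infty\}$ are proper, closed, strongly convex functions with ${\rm dom}(\psi)=X$ and ${\rm dom}(\phi)=Y$, where ${\rm dom}(\psi)=\{x:\psi(x)<\infty\}$; they are continuously differentiable with Lipschitz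 continuous gradients on their domains (i.e. on $X$, $\psi$ coincides with a function that is continuously differentiable on an open set containing $X$, whose gradient on $X$ is denoted $\nabla\psi$ and is Lipschitz on $X$; likewise for $\phi$ on $Y$); and $\nabla\psi^*$, $\nabla\phi^*$ are Lipschitz continuous. Here $\psi^*(u)=\sup_x\{x^{\rm T}u-\psi(x)\}$ is the convex conjugate, which is differentiable with $\nabla\psi^*(u)={\rm argmin}_{x\in X}\{-x^{\rm T}u+\psi(x)\}$ (similarly for $\phi^*$). Notation: $z=[x^{\rm T},y^{\rm T}]^{\rm T}$, $w=[u^{\rm T},v^{\rm T}]^{\rm T}$ with $x,u\in\mathbb R^p$, $y,v\in\mathbb R^q$; $\nabla R(z)=[\nabla F(x)^{\rm T},\nabla G(y)^{\rm T}]^{\rm T}$; $\tilde H=\begin{bmatrix}0_{p\times p}&H\\-H^{\rm T}&0_{q\times q}\end{bmatrix}$; $\nabla\pi^*(w)=[\nabla\psi^*(u)^{\rm T},\nabla\phi^*(v)^{\rm T}]^{\rm T}$; $\nabla\pi(z)=[\nabla\psi(x)^{\rm T},\nabla\phi(y)^{\rm T}]^{\rm T}$. A solution is a pair of functions continuous on $[0,\infty)$ and differentiable on $(0,\infty)$ that satisfies the differential equations for all $t>0$ and the initial conditions at $t=0$ (the coefficient $r/t$ is singular at $t=0$). *)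

(* Defs.v *)
From HB Require Import structures.
From mathcomp Require Import all_boot all_order all_algebra.
From mathcomp Require Import all_classical all_reals all_analysis.

Set Implicit Arguments.
Unset Strict Implicit.
Unset Printing Implicit Defensive.

Import Order.TTheory GRing.Theory Num.Theory.
Import numFieldNormedType.Exports.

Local Open Scope ring_scope.
Local Open Scope classical_set_scope.

Section Calculus.
Variables (R : realType) (n : nat).
Implicit Types (f : 'cV[R]_n -> R) (psi : 'cV[R]_n -> \bar R).

Definition dotv (x y : 'cV[R]_n) : R := (x^T *m y) 0 0.

Definition grad f (x : 'cV[R]_n) : 'cV[R]_n :=
  \col_i 'D_(delta_mx i 0) f x.

(* Only used with U open; the values of f outside U are then irrelevant. *)
Definition C1_on (U : set 'cV[R]_n) f : Prop :=
  forall x, U x -> differentiable f x /\ {for x, continuous (grad f)}.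

(* U is not required to be convex: only segments contained in U are tested.
   For a convex U this is the usual notion. *)
Definition strictly_convex_on (U : set 'cV[R]_n) f : Prop :=
  forall x y : 'cV[R]_n, x <> y ->
    (forall s : R, 0 <= s <= 1 -> U (s *: x + (1 - s) *: y)) ->
  forall t : R, 0 < t < 1 ->
    f (t *: x + (1 - t) *: y) < t * f x + (1 - t) * f y.

Definition proper_fun psi : Prop :=
  (forall x, psi x != -oo%E) /\ exists x, psi x != +oo%E.

Definition edom psi : set 'cV[R]_n := [set x | (psi x < +oo)%E].

Definition closed_fun psi : Prop :=
  closed [set xa : 'cV[R]_n * R | (psi xa.1 <= xa.2%:E)%E].

Definition strongly_convex psi : Prop :=
  exists2 m : R, 0 < m & forall (x y : 'cV[R]_n) (t : R), 0 < t < 1 ->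
    (psi (t *: x + (1 - t) *: y)%R
       + (m / 2 * t * (1 - t) * dotv (x - y) (x - y))%:E
     <= t%:E * psi x + (1 - t)%:E * psi y)%E.

Definition conjugate psi (u : 'cV[R]_n) : \bar R :=
  ereal_sup (range (fun x => ((dotv x u)%:E - psi x)%E)).

(* The conjugate of a proper closed strongly convex function is finite
   everywhere, so that [fine] loses nothing. *)
Definition grad_conj psi : 'cV[R]_n -> 'cV[R]_n :=
  grad (fun u => fine (conjugate psi u)).

(* The library's Lipschitz predicate uses the max norm of 'cV[R]_n; since the
   constant is existentially quantified, the choice of norm is immaterial. *)
Definition smooth_strictly_convex (X : set 'cV[R]_n) f : Prop :=
  (exists U : set 'cV[R]_n,
    [/\ open U, X `<=` U, C1_on U f & strictly_convex_on U f]) /\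
  [lipschitz (grad f) x | x in X].

(* psi_s is the continuously differentiable function that coincides with psi
   on X.  It is explicit because, when X has empty interior, the gradient of
   psi on X depends on its choice. *)
Record mirror_map (X : set 'cV[R]_n) psi (psi_s : 'cV[R]_n -> R) : Prop := {
  mirror_proper : proper_fun psi;
  mirror_closed : closed_fun psi;
  mirror_strongly_convex : strongly_convex psi;
  mirror_dom : edom psi = X;
  mirror_C1 : exists U : set 'cV[R]_n, [/\ open U, X `<=` U & C1_on U psi_s];
  mirror_ext : forall x, X x -> psi x = (psi_s x)%:E;
  mirror_lipschitz : [lipschitz (grad psi_s) x | x in X];
  mirror_conj_lipschitz : lipschitz (grad_conj psi) }.

End Calculus.

Section SaddlePoint.
Variables (R : realType) (p q : nat).

Definition saddle_fun (F : 'cV[R]_p -> R) (G : 'cV[R]_q -> R)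
    (H : 'M[R]_(p, q)) (x : 'cV[R]_p) (y : 'cV[R]_q) : R :=
  F x + dotv x (H *m y) - G y.

Definition saddle_point (X : set 'cV[R]_p) (Y : set 'cV[R]_q)
    (L : 'cV[R]_p -> 'cV[R]_q -> R) (xy : 'cV[R]_p * 'cV[R]_q) : Prop :=
  [/\ X xy.1, Y xy.2 & forall x y, X x -> Y y ->
        L xy.1 y <= L xy.1 xy.2 <= L x xy.2].

Record assumptionA (H : 'M[R]_(p, q)) (X : set 'cV[R]_p) (Y : set 'cV[R]_q)
    (F : 'cV[R]_p -> R) (G : 'cV[R]_q -> R) : Prop := {
  A_X : [/\ X !=set0, closed X & convex_set X];
  A_Y : [/\ Y !=set0, closed Y & convex_set Y];
  A_F : smooth_strictly_convex X F;
  A_G : smooth_strictly_convex Y G;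
  A_saddle : exists! xy, saddle_point X Y (saddle_fun F G H) xy }.

Definition assumptionB (X : set 'cV[R]_p) (Y : set 'cV[R]_q)
    (psi : 'cV[R]_p -> \bar R) (phi : 'cV[R]_q -> \bar R)
    (psi_s : 'cV[R]_p -> R) (phi_s : 'cV[R]_q -> R) : Prop :=
  mirror_map X psi psi_s /\ mirror_map Y phi phi_s.

Definition stack (f : 'cV[R]_p -> 'cV[R]_p) (g : 'cV[R]_q -> 'cV[R]_q)
    (z : 'cV[R]_(p + q)) : 'cV[R]_(p + q) :=
  col_mx (f (usubmx z)) (g (dsubmx z)).

Definition Htilde (H : 'M[R]_(p, q)) : 'M[R]_(p + q) :=
  block_mx 0 H (- H^T) 0.

(* Only the values of z and w on [0, +oo[ matter. *)
Record solution (r : R) (H : 'M[R]_(p, q))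
    (gradR gradpi gradpi_conj : 'cV[R]_(p + q) -> 'cV[R]_(p + q))
    (z0 w0 : 'cV[R]_(p + q)) (z w : R -> 'cV[R]_(p + q)) : Prop := {
  sol_z_continuous : {within `[0, +oo[, continuous z};
  sol_w_continuous : {within `[0, +oo[, continuous w};
  sol_derivable : forall t : R, 0 < t -> derivable z t 1 /\ derivable w t 1;
  sol_z_eq : forall t : R, 0 < t ->
    derive1 z t = (r / t) *: (gradpi_conj (w t) - z t);
  sol_w_eq : forall t : R, 0 < t ->
    derive1 w t = (t / r) *:
      (- gradR (z t) - Htilde H *m (z t + (t / r) *: derive1 z t)
       + gradpi (z t + (t / r) *: derive1 z t) - w t);
  sol_z_init : z 0 = z0;
  sol_w_init : w 0 = w0 }.

End SaddlePoint.

(* Main.v *)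
Require Import Defs.
From HB Require Import structures.
From mathcomp Require Import all_boot all_order all_algebra.
From mathcomp Require Import all_classical all_reals all_analysis.
From mathcomp Require Import ring lra.

Set Implicit Arguments.
Unset Strict Implicit.
Unset Printing Implicit Defensive.

Import Order.TTheory GRing.Theory Num.Theory.
Import numFieldNormedType.Exports.

Local Open Scope ring_scope.
Local Open Scope classical_set_scope.

(* Away from [t = 0] the first equation says that [z + (t / r) z' = N w], where
   [N] is the gradient of the conjugate, so the second one becomes
   [w' = (t / r) (Q w - B z)] with [N] and [Q] Lipschitz, and [B], the gradient
   of [(F, G)], Lipschitz on [X * Y].  Given [w], the singular first equation is
   solved by the weighted average of [N w] over [[0, t]]; the substitution
   [s = t^r] makes this average a primitive of a continuous function.  Since [N]
   takes values in the closed convex set [X * Y], so does [z], and [z] depends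
   on [w] with the Lipschitz constant of [N].  Hence the Picard map on [w] is a
   contraction for a norm weighted by [exp (c t^2)], which gives existence on
   the whole half-line and uniqueness. *)

(** * Primitives and increments *)

(** Two obstacles shape the proof. The coefficient [r / t] is not integrable at [0], so the first
    equation is only used in the form [(t^r z)' = (t^r)' N w], whose boundary term at [0] vanishes.
    And [B] is controlled on [X * Y] alone, so every iterate must be located there before it can be
    estimated. This is what the part on strong convexity is for: [grad_conj] is a vector of partial
    derivatives of a supremum, and it is seen to lie in the domain only after it is identified with
    a minimizer. The quadratic exponent of the weight matches the coefficient [t / r], which grows
    linearly; the contraction ratio is then the same on every time interval. Functions are total on
    the line and are frozen at negative times through [Num.max 0], so that plain continuity can
    replace continuity within the half-line. Norms of vectors are max norms, whereas convexity and
    projections use [dotv]; the factors equal to the dimension come from passing between the two. *)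

Lemma is_derive_mxP (R : realFieldType) (m n : nat) (M : R -> 'M[R]_(m, n))
    (t : R) (D : 'M[R]_(m, n)) :
  is_derive t 1 M D <-> forall i j, is_derive t 1 (fun s => M s i j) (D i j).
Proof.
split=> [[Mt <-] i j|MD].
  split; first exact: (derivable_mxP M t 1).1.
  by rewrite derive_mx// mxE.
have Mt : derivable M t 1 by apply/derivable_mxP => i j; case: (MD i j).
split=> //; rewrite derive_mx//; apply/matrixP => i j; rewrite mxE.
by case: (MD i j).
Qed.

Lemma mx_coord_norm (R : realFieldType) (m n : nat) (M : 'M[R]_(m, n)) i j :
  `|M i j| <= `|M|.
Proof.
rewrite [leRHS]/Num.Def.normr/= mx_normrE.
exact: (le_bigmax _ (fun ij => `|M ij.1 ij.2|) (i, j)).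
Qed.

Lemma mx_norm_le (R : realFieldType) (m n : nat) (M : 'M[R]_(m, n)) (e : R) :
  0 <= e -> (forall i j, `|M i j| <= e) -> `|M| <= e.
Proof.
by move=> e0 Me; rewrite /Num.Def.normr/= mx_normrE bigmax_le// => -[i j] _.
Qed.

Lemma cvg_mxP (R : realFieldType) (m n : nat) (T : Type) (F : set_system T)
    (FF : Filter F) (M : T -> 'M[R]_(m, n)) (L : 'M[R]_(m, n)) :
  M x @[x --> F] --> L <-> forall i j, M x i j @[x --> F] --> L i j.
Proof.
split=> [/cvgrPdist_le ML i j|ML].
  apply/cvgrPdist_le => e e0; near=> x.
  apply: (@le_trans _ _ `|L - M x|).
    by have := mx_coord_norm (L - M x) i j; rewrite !mxE.
  by near: x; exact: ML.
apply/cvgrPdist_le => e e0; near=> x.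
apply: mx_norm_le; first exact: ltW.
suff H : forall ij : 'I_m * 'I_n, `|(L - M x) ij.1 ij.2| <= e.
  by move=> i j; exact: (H (i, j)).
near: x; apply: filter_forall => -[i j] /=.
have /cvgrPdist_le/(_ e e0) := ML i j.
by apply: filterS => x; rewrite !mxE.
Unshelve. all: by end_near. Qed.

(** Mean value theorem for [g - f]. Derivatives are asked for in the open interval only, since [t^r]
    need not be differentiable at [0]. *)
Lemma le_increment (R : realType) (f g df dg : R -> R) (a b : R) : a <= b ->
  continuous f -> continuous g ->
  (forall s, a < s < b -> is_derive s 1 f (df s)) ->
  (forall s, a < s < b -> is_derive s 1 g (dg s)) ->
  (forall s, a < s < b -> df s <= dg s) ->
  f b - f a <= g b - g a.
Proof.
rewrite le_eqVlt => /predU1P[-> *|ab cf cg fdf gdg dfg]; first by rewrite !subrr.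
have [||c cab] := @MVT R (g - f) (dg \- df) a b ab.
- move=> s; rewrite in_itv/= => sab.
  by have := fdf s sab; have := gdg s sab => ? ?; exact: is_deriveB.
- by apply: continuous_subspaceT => s; apply: continuousB; [exact: cg|exact: cf].
move=> /= E; have : 0 <= (dg c - df c) * (b - a).
  by rewrite mulr_ge0// ?subr_ge0 ?(ltW ab)// dfg.
by rewrite -E !fctE; lra.
Qed.

(** Stands in for bounding the norm of an integral by the integral of the norm; with the max norm it
    reduces to two scalar comparisons per coordinate. *)
Lemma norm_increment (R : realType) (n : nat) (f df : R -> 'cV[R]_n)
    (g dg : R -> R) (a b : R) : a <= b ->
  continuous f -> continuous g ->
  (forall s, a < s < b -> is_derive s 1 f (df s)) ->
  (forall s, a < s < b -> is_derive s 1 g (dg s)) ->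
  (forall s, a < s < b -> `|df s| <= dg s) ->
  `|f b - f a| <= g b - g a.
Proof.
move=> ab cf cg fdf gdg dfg.
have cfi i : continuous (fun s => f s i 0).
  by move=> s; apply: (cvg_mxP _ f (f s)).1; exact: cf.
have fi i s : a < s < b -> is_derive s 1 (fun s => f s i 0) (df s i 0).
  by move=> sab; exact: (is_derive_mxP _ _ _).1 (fdf s sab) i 0.
have dfi i s : a < s < b -> - dg s <= df s i 0 <= dg s.
  by move=> sab; rewrite -ler_norml (le_trans (mx_coord_norm _ _ _))// dfg.
have H i : `|f b i 0 - f a i 0| <= g b - g a.
  rewrite ler_norml lerNl; apply/andP; split; last first.
    apply: (le_increment ab (cfi i) cg (fi i) gdg) => s sab.
    by have /andP[] := dfi i s sab.
  have := @le_increment R (fun s => - f s i 0) g (fun s => - df s i 0) dg a b ab.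
  rewrite opprK opprB addrC; apply => //.
  - by move=> s; apply: continuousN; exact: cfi.
  - by move=> s sab; have := fi i s sab => ?; exact: is_deriveN.
  - by move=> s sab; have /andP[+ _] := dfi i s sab; rewrite lerNl.
(* Nonnegativity of the bound needs its own comparison, with the zero function: for [n = 0] there is
   no coordinate to deduce it from. *)
apply: mx_norm_le => [|i j].
  have := @le_increment R (cst 0) g (cst 0) dg a b ab; rewrite subrr; apply => //.
  - by move=> s; exact: cvg_cst.
  - by move=> s sab; rewrite (le_trans _ (dfg s sab)).
by rewrite !mxE ord1.
Qed.

Lemma primitive_exists (R : realType) (f : R -> R) : continuous f ->
  exists P : R -> R, [/\ continuous P, P 0 = 0 &
    forall t : R, 0 < t -> is_derive t 1 P (f t)].
Proof.
(* Integrating from [-1] puts [0] in the interior, which gives continuity there; [F 0] is subtracted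
   afterwards and the argument frozen at negative times. *)
move=> cf; pose F (x : R) : R := (\int[lebesgue_measure]_(t in `[(-1)%R, x]) (f t))%R.
have dF (x : R) : -1 < x -> is_derive x 1 F (f x).
  move=> x1; have [||//|dF FE] := @continuous_FTC1_closed R f (-1) x (x + 1) _ _ x1.
  - by rewrite ltrDl.
  - apply: continuous_compact_integrable; first exact: segment_compact.
    exact: continuous_subspaceT.
  - exact: cf.
  by apply: DeriveDef; [exact: dF|rewrite -derive1E; exact: FE].
have cF (x : R) : -1 < x -> {for x, continuous F}.
  by move=> /dF[+ _] => /derivable1_diffP; exact: differentiable_continuous.
exists (fun t => F (Num.max 0 t) - F 0); split.
- move=> t; apply: cvgB; last exact: cvg_cst.
  apply: (@continuous_comp R R R (fun t => Num.max 0 t) F).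
    by apply: continuous_max; [exact: cvg_cst|exact: cvg_id].
  by apply: cF; rewrite lt_max; apply/orP; left; lra.
- by rewrite maxxx subrr.
move=> t t0; apply: (@near_eq_is_derive _ _ _ (F - cst (F 0))).
  near=> s; rewrite !fctE max_r//.
  by apply: ltW; near: s; exact: lt_nbhsr.
rewrite -[f t]subr0; apply: is_deriveB; apply: dF; lra.
Unshelve. all: by end_near. Qed.

Lemma primitive_cV_exists (R : realType) (n : nat) (f : R -> 'cV[R]_n) :
  continuous f ->
  exists P : R -> 'cV[R]_n, [/\ continuous P, P 0 = 0 &
    forall t : R, 0 < t -> is_derive t 1 P (f t)].
Proof.
move=> cf; have /choice[P PP] : forall i, exists P : R -> R, [/\ continuous P,
    P 0 = 0 & forall t : R, 0 < t -> is_derive t 1 P (f t i 0)].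
  move=> i; apply: primitive_exists => t.
  exact: (cvg_mxP _ f (f t)).1 (cf t) i 0.
exists (fun t => \col_i P i t); split.
- move=> t; apply/(cvg_mxP _ (fun t => \col_i P i t)) => i j; rewrite mxE.
  under eq_fun do rewrite mxE.
  by have [+ _ _] := PP i; exact.
- by apply/matrixP => i j; rewrite !mxE; have [] := PP i.
move=> t t0; apply/is_derive_mxP => i j; rewrite ord1.
under eq_fun do rewrite mxE.
by have [_ _] := PP i; exact.
Qed.

Lemma is_derive_scale_cV (R : realType) (n : nat) (c : R -> R) (dc : R)
    (f : R -> 'cV[R]_n) (df : 'cV[R]_n) (t : R) :
  is_derive t 1 c dc -> is_derive t 1 f df ->
  is_derive t 1 (fun s => c s *: f s) (c t *: df + dc *: f t).
Proof.
move=> cdc /is_derive_mxP fdf; apply/is_derive_mxP => i j; rewrite !mxE.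
under eq_fun do rewrite mxE.
have := fdf i j => fij.
have := @is_deriveM R R c (fun s => f s i j) t 1 dc (df i j) cdc fij.
by move/is_derive_eq; apply; rewrite /GRing.scale/= [f t i j * _]mulrC.
Qed.

Lemma is_derive_comp_cV (R : realType) (n : nat) (f : R -> 'cV[R]_n)
    (df : 'cV[R]_n) (c : R -> R) (dc : R) (t : R) :
  is_derive t 1 c dc -> is_derive (c t) 1 f df ->
  is_derive t 1 (fun s => f (c s)) (dc *: df).
Proof.
move=> cdc /is_derive_mxP fdf; apply/is_derive_mxP => i j; rewrite !mxE.
have := fdf i j => fij.
by rewrite mulrC; exact: (@is_derive1_comp R (fun s => f s i j) c).
Qed.

Lemma is_derive_dotv (R : realType) (n : nat) (d : 'cV[R]_n)
    (f : R -> 'cV[R]_n) (df : 'cV[R]_n) (t : R) :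
  is_derive t 1 f df -> is_derive t 1 (fun s => dotv d (f s)) (dotv d df).
Proof.
move=> /is_derive_mxP fdf; rewrite /dotv mxE.
rewrite (_ : (fun s => _) = \sum_i (d^T 0 i \*: (fun s => f s i 0))).
  by apply: is_derive_sum => i; exact: is_deriveZ.
by apply/funext => s; rewrite mxE fct_sumE.
Qed.

Lemma continuous_dotv (R : realType) (n : nat) (d : 'cV[R]_n) :
  continuous (dotv d).
Proof.
move=> x; rewrite /continuous_at /dotv mxE.
rewrite (_ : (fun y => (d^T *m y) 0 0) = fun y => \sum_i d^T 0 i * y i 0); last first.
  by apply/funext => s; rewrite mxE.
apply: (@cvg_big R _ +%R _ _ _ _ (nbhs x)) => [|i _].
- exact: add_continuous.
- apply: cvgM; [exact: cvg_cst|].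
  exact: (@coord_continuous _ _ _ i 0 x).
Qed.

Lemma is_derive_continuous (R : realType) (n : nat) (f : R -> 'cV[R]_n)
    (df : 'cV[R]_n) (t : R) : is_derive t 1 f df -> {for t, continuous f}.
Proof. by case=> + _ => /derivable1_diffP; exact: differentiable_continuous. Qed.

(** The power is taken of the positive part, so that for [r > 0] it vanishes for [t <= 0] and is
    continuous and monotone on the whole line. *)
Definition pospow (R : realType) (r t : R) : R := Num.max 0 t `^ r.

Lemma pospow0 (R : realType) (r : R) : 0 < r -> pospow r 0 = 0.
Proof. by move=> r0; rewrite /pospow maxxx powR0// gt_eqF. Qed.

Lemma pospow_gt0 (R : realType) (r t : R) : 0 < t -> 0 < pospow r t.
Proof. by move=> t0; rewrite /pospow powR_gt0// lt_max t0 orbT. Qed.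

Lemma pospow_ge0 (R : realType) (r t : R) : 0 <= pospow r t.
Proof. exact: powR_ge0. Qed.

Lemma pospow_le (R : realType) (r s t : R) : 0 <= r -> s <= t ->
  pospow r s <= pospow r t.
Proof.
move=> r0 st; by apply: ge0_ler_powR => //; rewrite ?nnegrE ?ge_max ?le_max ?lexx ?st ?orbT.
Qed.

Lemma pospowK (R : realType) (r t : R) : 0 < r -> 0 <= t ->
  pospow r^-1 (pospow r t) = t.
Proof.
move=> r0 t0; rewrite /pospow (max_r (powR_ge0 _ _)) (max_r t0) -powRrM.
by rewrite mulfV ?gt_eqF// powRr1.
Qed.

Lemma is_derive_pospow (R : realType) (r t : R) : 0 < t ->
  is_derive t 1 (pospow r) (r * (pospow r t / t)).
Proof.
move=> t0; apply: (@near_eq_is_derive _ _ _ (fun s => s `^ r)).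
  near=> s; rewrite /pospow max_r//; apply: ltW; near: s; exact: lt_nbhsr.
apply: is_derive_eq; first exact: is_derive1_powR.
rewrite /pospow (max_r (ltW t0)) powRB; last by rewrite (gt_eqF t0) implybT.
by rewrite powRr1 ?ltW.
Unshelve. all: by end_near. Qed.

Lemma continuous_pospow (R : realType) (r : R) : 0 < r -> continuous (pospow r).
Proof.
move=> r0 t; have [t0|t0|<-] := ltgtP 0 t.
- have [+ _] := is_derive_pospow r t0.
  by move=> /derivable1_diffP; exact: differentiable_continuous.
- apply: cvg_near_cst; near=> s.
  rewrite /pospow (max_l (ltW t0)) max_l//.
  by apply: ltW; near: s; exact: lt_nbhsl.
apply/cvgrPdist_le => e e0; near=> s.
rewrite pospow0// sub0r normrN ger0_norm ?pospow_ge0//.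
(* Writing [e] as an [r]-th power reduces continuity at [0] to monotonicity. *)
have -> : e = pospow r (pospow r^-1 e).
  by have := @pospowK R r^-1 e; rewrite invrK => ->; rewrite ?invr_gt0 ?ltW.
rewrite pospow_le ?(ltW r0)//; apply: le_trans (ler_norm _) _.
near: s; apply: (@nbhs0_le R R); exact: pospow_gt0.
Unshelve. all: by end_near. Qed.

(* [pospow r] is the integrating factor of the averaging equation
   [z' = (r / t) (g - z)]. *)
Lemma is_derive_pospow_average (R : realType) (n : nat) (r t : R)
    (z : R -> 'cV[R]_n) (g : 'cV[R]_n) : 0 < t ->
  is_derive t 1 z ((r / t) *: (g - z t)) ->
  is_derive t 1 (fun s => pospow r s *: z s) ((r * (pospow r t / t)) *: g).
Proof.
move=> t0 dz.
have := is_derive_scale_cV (is_derive_pospow r t0) dz.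
move/is_derive_eq; apply; rewrite scalerA mulrCA scalerBr.
by rewrite [r * _]mulrCA mulrA subrK.
Qed.

(** * The averaging equation *)

Definition average (R : realType) (n : nat) (r : R) (g z : R -> 'cV[R]_n) :=
  [/\ continuous z, z 0 = g 0 &
      forall t : R, 0 < t -> is_derive t 1 z ((r / t) *: (g t - z t))].

(** The derivative of [t^r (z - z')] is [(t^r)' (g - g')], of norm at most [K (t^r)'], and both
    quantities start from [0]; dividing by [t^r] gives the bound. The case [K = 0] is uniqueness of
    the average. *)
Lemma average_close (R : realType) (n : nat) (r T K : R)
    (g g' z z' : R -> 'cV[R]_n) : 0 < r ->
  average r g z -> average r g' z' ->
  (forall s : R, 0 < s <= T -> `|g s - g' s| <= K) ->
  forall s : R, 0 < s <= T -> `|z s - z' s| <= K.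
Proof.
move=> r0 [cz _ dz] [cz' _ dz'] gK t /andP[t0 tT].
have dzz' (s : R) : 0 < s -> is_derive s 1 (fun s => pospow r s *: (z s - z' s))
    ((r * (pospow r s / s)) *: (g s - g' s)).
  move=> s0; apply: is_derive_pospow_average => //.
  have := is_deriveB (dz s s0) (dz' s s0).
  move/is_derive_eq; apply; rewrite -scalerBr; congr (_ *: _).
  by apply/matrixP => i j; rewrite !mxE; ring.
have := @norm_increment R n (fun s => pospow r s *: (z s - z' s))
  (fun s => (r * (pospow r s / s)) *: (g s - g' s))
  (K \*: pospow r) (fun s => K *: (r * (pospow r s / s))) 0 t (ltW t0).
rewrite /= pospow0// scale0r subr0 scaler0 subr0 normrZ ger0_norm ?pospow_ge0//.
rewrite mulrC ler_pM2r ?pospow_gt0//; apply.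
- move=> s; apply: cvgZ; first exact: continuous_pospow.
  by apply: cvgB; [exact: cz|exact: cz'].
- by move=> s; apply: cvgZr; exact: continuous_pospow.
- by move=> s /andP[s0 _]; exact: dzz'.
- by move=> s /andP[s0 _]; apply: is_deriveZ; exact: is_derive_pospow.
move=> s /andP[s0 st]; have p0 : 0 <= r * (pospow r s / s).
  by rewrite mulr_ge0 ?divr_ge0 ?pospow_ge0 ?ltW.
by rewrite normrZ (ger0_norm p0) [leRHS]mulrC ler_wpM2l// gK// s0 (le_trans (ltW st)).
Qed.

(** The solution is [t^-r P (t^r)], with [P] a primitive of [g (s^(1/r))]. Continuity at [0] says
    that [P u / u] tends to [g 0] as [u] decreases to [0]. *)
Lemma average_exists (R : realType) (n : nat) (r : R) (g : R -> 'cV[R]_n) :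
  0 < r -> continuous g -> exists z, average r g z.
Proof.
move=> r0 cg; have ri0 : 0 < r^-1 by rewrite invr_gt0.
pose m := pospow r^-1.
have cgm : continuous (fun s => g (m s)).
  by move=> s; apply: (@continuous_comp R R _ m g); [exact: continuous_pospow|exact: cg].
have [P [cP P0 dP]] := primitive_cV_exists cgm.
pose z (t : R) := if t <= 0 then g 0 else (pospow r t)^-1 *: P (pospow r t).
have dz (t : R) : 0 < t -> is_derive t 1 z ((r / t) *: (g t - z t)).
  move=> t0.
  apply: (@near_eq_is_derive _ _ _ (fun s => (pospow r s)^-1 *: P (pospow r s))).
    near=> s; rewrite /z ifF//; apply/negbTE; rewrite -ltNge.
    by near: s; exact: lt_nbhsr.
  have p0 : 0 < pospow r t := pospow_gt0 r t0.
  have pn0 : pospow r t != 0 by rewrite gt_eqF.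
  have := is_derive_scale_cV (is_deriveV pn0 (is_derive_pospow r t0))
    (is_derive_comp_cV (is_derive_pospow r t0) (dP _ p0)).
  move/is_derive_eq; apply; rewrite /m pospowK ?ltW// /z leNgt t0/=.
  apply/matrixP => i j; rewrite !mxE /GRing.scale/=.
  by field; rewrite pn0 gt_eqF.
exists z; split=> // [t|]; last by rewrite /z lexx.
have [t0|t0|<-{t}] := ltgtP 0 t.
- exact: is_derive_continuous (dz t t0).
- apply: cvg_near_cst; near=> s; rewrite /z (ltW t0) ifT//.
  by apply: ltW; near: s; exact: lt_nbhsl.
apply/cvgrPdist_le => e e0.
have /cvgrPdist_le/(_ e e0)/nbhs_ballP[d /= d0 gd] := cg 0.
have -> : z 0 = g 0 by rewrite /z lexx.
near=> t; rewrite /z; case: ifPn => [_|]; first by rewrite subrr normr0 ltW.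
rewrite -ltNge => t0; have p0 : 0 < pospow r t := pospow_gt0 r t0.
have pn0 : pospow r t != 0 by rewrite gt_eqF.
rewrite -[g 0](scalerK pn0) -scalerBr normrZ gtr0_norm ?invr_gt0//.
rewrite ler_pdivrMl// distrC.
(* After multiplication by [t^r] the claim is an increment bound for [P s - s *: g 0], whose
   derivative is small near [0]. *)
suff : `|P (pospow r t) - pospow r t *: g 0 - (P 0 - 0 *: g 0)|
    <= e * pospow r t - e * 0.
  by rewrite P0 scale0r subrr subr0 mulr0 subr0 mulrC.
apply: (@norm_increment R n (fun s => P s - s *: g 0) (fun s => g (m s) - g 0)
  (fun s => e * s) (fun=> e)); first exact: pospow_ge0.
- move=> s; apply: cvgB; first exact: cP.
  by apply: cvgZ; [exact: cvg_id|exact: cvg_cst].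
- by move=> s; apply: cvgM; [exact: cvg_cst|exact: cvg_id].
- move=> s /andP[s0 _]; apply: is_deriveB; first exact: dP.
  have := @is_derive_scale_cV R n id 1 (cst (g 0)) 0 s (is_derive_id _ _)
    (is_derive_cst _ _ _).
  by move/is_derive_eq; apply; rewrite scaler0 add0r scale1r.
- move=> s _; have := @is_deriveZ R R R id e s 1 1 (is_derive_id _ _).
  by move/is_derive_eq; apply; rewrite /GRing.scale/= mulr1.
move=> s /andP[s0 st]; rewrite distrC.
apply: gd; rewrite /ball/= sub0r normrN ger0_norm ?pospow_ge0//.
apply: (@le_lt_trans _ _ t).
  by rewrite -[leRHS](pospowK r0 (ltW t0)) pospow_le ?ltW.
apply: le_lt_trans (ler_norm _) _.
near: t; exact: (@nbhs0_lt R R).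
Unshelve. all: by end_near. Qed.

(** * Strong convexity and the conjugate *)

Lemma dotvE (R : realType) (n : nat) (x y : 'cV[R]_n) :
  dotv x y = \sum_i x i 0 * y i 0.
Proof. by rewrite /dotv mxE; apply: eq_bigr => i _; rewrite mxE. Qed.

Lemma dotvC (R : realType) (n : nat) (x y : 'cV[R]_n) : dotv x y = dotv y x.
Proof. by rewrite !dotvE; apply: eq_bigr => i _; rewrite mulrC. Qed.

Lemma dotvDl (R : realType) (n : nat) (x y z : 'cV[R]_n) :
  dotv (x + y) z = dotv x z + dotv y z.
Proof. by rewrite /dotv linearD mulmxDl mxE. Qed.

Lemma dotvZl (R : realType) (n : nat) (a : R) (x z : 'cV[R]_n) :
  dotv (a *: x) z = a * dotv x z.
Proof. by rewrite /dotv linearZ/= -scalemxAl mxE. Qed.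

Lemma dotvBl (R : realType) (n : nat) (x y z : 'cV[R]_n) :
  dotv (x - y) z = dotv x z - dotv y z.
Proof. by rewrite dotvDl -scaleN1r dotvZl mulN1r. Qed.

Lemma dotvDr (R : realType) (n : nat) (z x y : 'cV[R]_n) :
  dotv z (x + y) = dotv z x + dotv z y.
Proof. by rewrite dotvC dotvDl ![dotv _ z]dotvC. Qed.

Lemma dotvZr (R : realType) (n : nat) (a : R) (z x : 'cV[R]_n) :
  dotv z (a *: x) = a * dotv z x.
Proof. by rewrite dotvC dotvZl dotvC. Qed.

Lemma dotvBr (R : realType) (n : nat) (z x y : 'cV[R]_n) :
  dotv z (x - y) = dotv z x - dotv z y.
Proof. by rewrite dotvC dotvBl ![dotv _ z]dotvC. Qed.

Lemma dotv_ge0 (R : realType) (n : nat) (x : 'cV[R]_n) : 0 <= dotv x x.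
Proof. by rewrite dotvE sumr_ge0// => i _; rewrite -expr2 sqr_ge0. Qed.

Lemma sqr_norm_le_dotv (R : realType) (n : nat) (x : 'cV[R]_n) :
  `|x| ^+ 2 <= dotv x x.
Proof.
have d0 := dotv_ge0 x; rewrite -(sqr_sqrtr d0).
rewrite lerXn2r ?nnegrE ?sqrtr_ge0//; apply: mx_norm_le; first exact: sqrtr_ge0.
move=> i j; rewrite ord1 -sqrtr_sqr ler_wsqrtr// dotvE (bigD1 i)//= -expr2 lerDl.
by rewrite sumr_ge0// => k _; rewrite -expr2 sqr_ge0.
Qed.

Lemma norm_dotv_le (R : realType) (n : nat) (x y : 'cV[R]_n) :
  `|dotv x y| <= n%:R * (`|x| * `|y|).
Proof.
rewrite dotvE (le_trans (ler_norm_sum _ _ _))//.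
rewrite (@le_trans _ _ (\sum_(i < n) `|x| * `|y|))//.
  by apply: ler_sum => i _; rewrite normrM ler_pM// mx_coord_norm.
by rewrite sumr_const card_ord mulr_natl.
Qed.

(** A real-valued form that includes stability of [X] under segments. The modulus carries no factor
    [1/2], so [dotv x x] has modulus exactly [1]. *)
Definition strongly_convex_in (R : realType) (n : nat) (X : set 'cV[R]_n)
    (m : R) (f : 'cV[R]_n -> R) :=
  forall x y, X x -> X y -> forall t : R, 0 < t < 1 ->
    X (t *: x + (1 - t) *: y) /\
    f (t *: x + (1 - t) *: y) + m * t * (1 - t) * dotv (x - y) (x - y)
      <= t * f x + (1 - t) * f y.

(** Continuity bounds [f] below on a ball of radius [e] around [a]. For [x] outside, strong
    convexity on the segment from [a] to [x], tested at distance [e] from [a], bounds [f x] below by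
    a quadratic in [rho], the norm of [x - a]. *)
Lemma strongly_convex_bounded_below (R : realType) (n : nat)
    (X : set 'cV[R]_n) (m : R) (f : 'cV[R]_n -> R) : 0 < m ->
  strongly_convex_in X m f -> (forall x, X x -> {for x, continuous f}) ->
  exists b, forall x, X x -> b <= f x.
Proof.
move=> m0 scf cf.
have [[a Xa]|X0] := pselect (X !=set0); last first.
  by exists 0 => x Xx; case: X0; exists x.
have /cvgrPdist_le/(_ 1 ltr01)/nbhs_ballP[d /= d0 ad] := cf a Xa.
have e0 : 0 < d / 2 by rewrite divr_gt0.
have ae x : `|x - a| <= d / 2 -> f a - 1 <= f x.
  move=> xa; suff : `|f a - f x| <= 1 by rewrite ler_norml; lra.
  by apply: ad; rewrite -ball_normE/= distrC (le_lt_trans xa)//; lra.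
set e := d / 2 in e0 ae.
(* The quadratic is [f a - k * rho + m * rho ^+ 2]; completing the square gives its minimum
   [f a - k ^+ 2 / (4 * m)]. The extra [-1] covers the ball. *)
pose k := e^-1 + m * e.
exists (f a - 1 - k ^+ 2 / (4 * m)) => x Xx.
have k0 : 0 <= k ^+ 2 / (4 * m) by rewrite divr_ge0 ?sqr_ge0//; lra.
have [xe|xe] := leP `|x - a| e; first by have := ae x xe; lra.
set rho := `|x - a| in xe.
have rho0 : 0 < rho by lra.
pose t := e / rho.
have t01 : 0 < t < 1 by rewrite divr_gt0//= ltr_pdivrMr// mul1r.
have [_ scx] := scf x a Xx Xa t t01.
have trho : t * rho = e by rewrite divfK// gt_eqF.
have : f a - 1 <= f (t *: x + (1 - t) *: a).
  apply: ae; rewrite (_ : _ - a = t *: (x - a)).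
    by rewrite normrZ gtr0_norm ?(andP t01).1 // trho.
  by rewrite scalerBr scalerBl scale1r addrA addrAC addrK.
have rho2 : rho ^+ 2 <= dotv (x - a) (x - a) := sqr_norm_le_dotv _.
have {}rho2 : m * t * (1 - t) * rho ^+ 2 <= m * t * (1 - t) * dotv (x - a) (x - a).
  have /andP[tt0 t1] := t01; rewrite ler_wpM2l//.
  by rewrite (mulr_ge0 (mulr_ge0 (ltW m0) (ltW tt0)))// subr_ge0 ltW.
move=> fa.
have : t * (f a - rho / e + m * rho * (rho - e)) <= t * f x.
  have -> : t * (f a - rho / e + m * rho * (rho - e)) =
      f a - 1 + m * t * (1 - t) * rho ^+ 2 - (1 - t) * f a.
    by rewrite /t; field; rewrite !gt_eqF.
  by lra.
rewrite ler_pM2l ?(andP t01).1// => H.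
apply: le_trans H.
have : 0 <= m * (rho - k / (2 * m)) ^+ 2 by rewrite mulr_ge0 ?sqr_ge0// ltW.
have -> : m * (rho - k / (2 * m)) ^+ 2 = m * rho ^+ 2 - k * rho + k ^+ 2 / (4 * m).
  by field; rewrite gt_eqF.
by rewrite /k; lra.
Qed.

(** Strong convexity makes a minimizing sequence Cauchy, so completeness and closedness of [X]
    replace compactness. *)
Lemma strongly_convex_argmin (R : realType) (n : nat)
    (X : set 'cV[R]_n) (m : R) (f : 'cV[R]_n -> R) : 0 < m ->
  X !=set0 -> closed X ->
  strongly_convex_in X m f -> (forall x, X x -> {for x, continuous f}) ->
  exists2 x, X x & forall y, X y -> f x <= f y.
Proof.
move=> m0 X0 clX scf cf.
have [b fb] := strongly_convex_bounded_below m0 scf cf.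
have infX : has_inf (f @` X).
  split; first by case: X0 => x Xx; exists (f x), x.
  by exists b => _ [x Xx <-]; exact: fb.
set I := inf (f @` X).
have If y : X y -> I <= f y by move=> Xy; apply: ge_inf; [exact: infX.2|exists y].
have /choice[x_ x_P] : forall k, exists x, X x /\ f x < I + harmonic k.
  move=> k; have [|_ [x Xx <-] fx] := inf_adherent _ infX (eps := harmonic k).
    by rewrite /harmonic/= invr_gt0.
  by exists x.
(* At the midpoint [f] is at least [I], while both endpoint values exceed [I] by less than
   [harmonic k]. *)
have close k l : (k <= l)%N -> m * `|x_ k - x_ l| ^+ 2 <= 4 * harmonic k.
  move=> kl; have [Xk fk] := x_P k; have [Xl fl] := x_P l.
  have [|/If] := scf _ _ Xk Xl 2^-1; first by apply/andP; split; lra.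
  have := sqr_norm_le_dotv (x_ k - x_ l).
  have : harmonic l <= harmonic k :> R.
    by rewrite /harmonic/= lef_pV2 ?posrE// ler_nat.
  move=> hkl H; have {}H : m * `|x_ k - x_ l| ^+ 2
      <= m * dotv (x_ k - x_ l) (x_ k - x_ l) by rewrite ler_pM2l.
  by lra.
have : cvgn x_.
  apply/cauchy_cvgP/cauchy_exP => e e0.
  have /cvgrPdist_lt/(_ (m * e ^+ 2 / 4)) := @cvg_harmonic R.
  have -> : 0 < m * e ^+ 2 / 4 by rewrite divr_gt0// mulr_gt0// exprn_gt0.
  move=> /(_ isT)[K _ Kh]; exists (x_ K); exists K => // l /= Kl.
  rewrite -ball_normE/= -(ltr_pXn2r (_ : (0 < 2)%N))// ?nnegrE ?normr_ge0 ?(ltW e0)//.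
  rewrite -(ltr_pM2l m0); apply: le_lt_trans (close _ _ Kl) _.
  have := Kh K (leqnn _); rewrite /= sub0r normrN ger0_norm; last first.
    by rewrite /harmonic/= invr_ge0.
  rewrite /harmonic/= ltr_pdivlMr// mulrC; exact.
move=> /cvg_ex[/= x x_x]; have Xx : X x.
  by apply: (closed_cvg X clX _ x x_x); apply: nearW => k; have [] := x_P k.
exists x => // y Xy; apply: le_trans (If y Xy).
have fx : f (x_ k) @[k --> \oo] --> f x by exact: (continuous_cvg _ (cf x Xx) x_x).
have hI : I + harmonic k @[k --> \oo] --> I.
  by rewrite -[X in _ --> X]addr0; apply: cvgD; [exact: cvg_cst|exact: cvg_harmonic].
apply: (ler_cvg_to fx hI); apply: nearW => k.
by apply: ltW; have [] := x_P k.
Qed.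

(** Compare [f x] with the value at the midpoint; this choice of point accounts for the factor
    [1/2]. *)
Lemma strongly_convex_growth (R : realType) (n : nat)
    (X : set 'cV[R]_n) (m : R) (f : 'cV[R]_n -> R) (x y : 'cV[R]_n) : 0 < m ->
  strongly_convex_in X m f -> X x -> X y -> (forall y, X y -> f x <= f y) ->
  f x + m / 2 * `|x - y| ^+ 2 <= f y.
Proof.
move=> m0 scf Xx Xy fx.
have [|/fx] := scf _ _ Xx Xy 2^-1; first by apply/andP; split; lra.
have := sqr_norm_le_dotv (x - y).
move=> H; have {}H : m * `|x - y| ^+ 2 <= m * dotv (x - y) (x - y).
  by rewrite ler_pM2l.
by lra.
Qed.

Lemma mirror_strongly_convex_in (R : realType) (n : nat) (X : set 'cV[R]_n)
    (psi : 'cV[R]_n -> \bar R) (psi_s : 'cV[R]_n -> R) :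
  mirror_map X psi psi_s ->
  exists2 m, 0 < m &
    forall u, strongly_convex_in X m (fun x => psi_s x - dotv x u).
Proof.
move=> mm; have [m m0 scm] := mirror_strongly_convex mm.
exists (m / 2) => [|u x y Xx Xy t t01]; first by rewrite divr_gt0.
have := scm x y t t01; rewrite (mirror_ext mm Xx) (mirror_ext mm Xy) -!EFinM -EFinD.
set c := t *: x + _ => H.
(* The right-hand side of the convexity inequality is finite, so [psi c] cannot be [+oo]. *)
have Xc : X c.
  rewrite -(mirror_dom mm) /edom/=.
  by case: (psi c) H => [a _|//|_] ; rewrite ?ltry ?ltNyr.
split=> //; move: H; rewrite (mirror_ext mm Xc) -EFinD lee_fin.
by rewrite /c (dotvDl (t *: x)) !dotvZl; lra.
Qed.

Lemma mirror_continuous (R : realType) (n : nat) (X : set 'cV[R]_n)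
    (psi : 'cV[R]_n -> \bar R) (psi_s : 'cV[R]_n -> R) (u : 'cV[R]_n) :
  mirror_map X psi psi_s ->
  forall x, X x -> {for x, continuous (fun x => psi_s x - dotv x u)}.
Proof.
move=> mm x Xx; have [U [_ XU C1U]] := mirror_C1 mm.
have [dx _] := C1U x (XU x Xx).
have cx : {for x, continuous psi_s} by exact: differentiable_continuous.
apply: continuousB; first exact: cx.
rewrite (_ : (fun y => dotv y u) = dotv u); first exact: continuous_dotv.
by apply/funext => y; rewrite dotvC.
Qed.

Lemma conjugate_argmin (R : realType) (n : nat) (X : set 'cV[R]_n)
    (psi : 'cV[R]_n -> \bar R) (psi_s : 'cV[R]_n -> R) (u x : 'cV[R]_n) :
  mirror_map X psi psi_s -> X x ->
  (forall y, X y -> psi_s x - dotv x u <= psi_s y - dotv y u) ->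
  conjugate psi u = (dotv x u - psi_s x)%:E.
Proof.
move=> mm Xx xmin; apply/eqP; rewrite eq_le; apply/andP; split.
  apply: ge_ereal_sup => _ [y _ <-].
  have [Xy|nXy] := pselect (X y).
    by rewrite (mirror_ext mm Xy) -EFinB lee_fin; have := xmin y Xy; lra.
  have -> : psi y = +oo%E.
    apply/eqP; rewrite -leye_eq leNgt; apply/negP => psiy; apply: nXy.
    by rewrite -(mirror_dom mm).
  by rewrite /= leNye.
by apply: ereal_sup_ubound; exists x => //; rewrite (mirror_ext mm Xx) -EFinB.
Qed.

(* The envelope argument: [dotv (N u) v] and [dotv (N (u + h v)) v] bracket the
   difference quotient of the conjugate at [u]. *)
Lemma is_derive_conjugate (R : realType) (n : nat) (c : 'cV[R]_n -> R)
    (N : 'cV[R]_n -> 'cV[R]_n) (k : R) (u v : 'cV[R]_n) :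
  (forall u u', c u + dotv (N u) (u' - u) <= c u') ->
  (forall u u', `|N u - N u'| <= k * `|u - u'|) ->
  is_derive u v c (dotv (N u) v).
Proof.
move=> cN kN; pose K := n%:R * (`|k| * `|v| * `|v|).
have K0 : 0 < K + 1 by rewrite ltr_wpDl// !mulr_ge0.
have H : h^-1 *: (c (h *: v + u) - c u) @[h --> 0^'] --> dotv (N u) v.
  apply/cvgrPdist_le => e e0; near=> h.
  have hn0 : h != 0 by near: h; exact: nbhs_dnbhs_neq.
  have l1 := cN u (h *: v + u); have l2 := cN (h *: v + u) u.
  rewrite addrK in l1; rewrite opprD addrCA subrr addr0 -scaleNr in l2.
  rewrite !dotvZr in l1 l2.
  have dN : `|dotv (N (h *: v + u) - N u) v| <= K * `|h|.
    rewrite (le_trans (norm_dotv_le _ _))// /K -mulrA ler_wpM2l//.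
    rewrite mulrAC ler_wpM2r//.
    rewrite (le_trans (kN _ _))// addrK normrZ [`|h| * _]mulrC mulrA.
    by rewrite !ler_wpM2r// ler_norm.
  rewrite dotvBl in dN.
  have -> : dotv (N u) v - h^-1 *: (c (h *: v + u) - c u) =
      h^-1 * (h * dotv (N u) v - (c (h *: v + u) - c u)).
    by rewrite mulrBr mulKf.
  rewrite normrM normfV ler_pdivrMl ?normr_gt0//.
  (* By [l1] and [l2] the quantity to bound lies between [h * dotv (N u - N (h *: v + u)) v] and
     [0], whatever the sign of [h]. *)
  apply: (@le_trans _ _ (`|h * (dotv (N (h *: v + u)) v - dotv (N u) v)|)).
    rewrite ler0_norm; last by lra.
    by apply: le_trans (ler_norm _); lra.
  rewrite normrM ler_wpM2l// (le_trans dN)//.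
  near: h; apply: nbhs_dnbhs; near=> h.
  apply: (@le_trans _ _ ((K + 1) * `|h|)); first by rewrite ler_wpM2r// lerDl.
  rewrite mulrC -ler_pdivlMr//; near: h; apply: (@nbhs0_le R R).
  exact: divr_gt0.
split; first by apply/cvg_ex; exists (dotv (N u) v).
exact: (cvg_lim _ H).
Unshelve. all: by end_near. Qed.

(** The gradient at [u] is the minimizer [N u] of [psi_s x - dotv x u] over [X]: [N u] is a
    subgradient of the conjugate and depends on [u] in a Lipschitz way, so the envelope argument
    applies. *)
Lemma grad_conj_in_dom (R : realType) (n : nat) (X : set 'cV[R]_n)
    (psi : 'cV[R]_n -> \bar R) (psi_s : 'cV[R]_n -> R) :
  closed X -> mirror_map X psi psi_s -> forall u, X (grad_conj psi u).
Proof.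
move=> clX mm.
have [m m0 scm] := mirror_strongly_convex_in mm.
have X0 : X !=set0.
  have [_ [x]] := mirror_proper mm.
  by rewrite -ltey => xlt; exists x; rewrite -(mirror_dom mm).
have /choice[N NP] : forall u, exists x, X x /\
    forall y, X y -> psi_s x - dotv x u <= psi_s y - dotv y u.
  move=> u; have [x Xx xmin] :=
    strongly_convex_argmin m0 X0 clX (scm u) (mirror_continuous (u := u) mm).
  by exists x.
have NX u : X (N u) by have [] := NP u.
have Nmin u := (NP u).2.
have cE u : conjugate psi u = (dotv (N u) u - psi_s (N u))%:E.
  exact: conjugate_argmin mm (NX u) (Nmin u).
have cN u u' : fine (conjugate psi u) + dotv (N u) (u' - u)
    <= fine (conjugate psi u').
  by rewrite !cE/= dotvBr; have := Nmin u' _ (NX u); lra.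
(* Adding the growth inequalities at [u] and [u'] bounds [m] times the squared norm of [N u - N u']
   by [dotv (N u - N u') (u - u')]; the factor [n] comes from [norm_dotv_le]. *)
have kN u u' : `|N u - N u'| <= n%:R / m * `|u - u'|.
  have [->|Nuu'] := eqVneq (N u) (N u').
    by rewrite subrr normr0 mulr_ge0// divr_ge0// ltW.
  have N0 : 0 < `|N u - N u'| by rewrite normr_gt0 subr_eq0.
  have := strongly_convex_growth m0 (scm u) (NX u) (NX u') (Nmin u).
  have := strongly_convex_growth m0 (scm u') (NX u') (NX u) (Nmin u').
  rewrite [`|N u' - _|]distrC => g1 g2.
  have d := ler_norm (dotv (N u - N u') (u - u')).
  have {}d := le_trans d (norm_dotv_le _ _).
  rewrite dotvBl !dotvBr in d.
  rewrite mulrAC ler_pdivlMr// -(ler_pM2r N0).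
  by rewrite (_ : `|N u - N u'| * m * _ = m * `|N u - N u'| ^+ 2); lra.
move=> u; suff -> : grad_conj psi u = N u by [].
apply/matrixP => i j; rewrite mxE ord1.
have [_ ->] := is_derive_conjugate u (delta_mx i 0) cN kN.
rewrite dotvE (bigD1 i)//= big1 ?addr0 => [|k ki].
  by rewrite !mxE !eqxx mulr1.
by rewrite !mxE (negbTE ki) mulr0.
Qed.

(** The point [c] is the Euclidean projection of [a]: up to the constant [dotv a a], [f x] is the
    squared Euclidean distance from [x] to [a]. *)
Lemma projection_exists (R : realType) (n : nat) (Z : set 'cV[R]_n)
    (a : 'cV[R]_n) :
  Z !=set0 -> closed Z ->
  (forall x y, Z x -> Z y -> forall t : R, 0 < t < 1 ->
    Z (t *: x + (1 - t) *: y)) ->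
  exists2 c, Z c & forall y, Z y -> dotv (a - c) (y - c) <= 0.
Proof.
move=> Z0 clZ cvZ; pose f x := dotv x x - 2 * dotv a x.
have scf : strongly_convex_in Z 1 f.
  move=> x y Zx Zy t t01; split; first exact: cvZ.
  rewrite /f !(dotvBl, dotvBr, dotvDl, dotvDr, dotvZl, dotvZr) (dotvC y x).
  by rewrite le_eqVlt; apply/orP; left; apply/eqP; ring.
have cf x : Z x -> {for x, continuous f}.
  move=> _; apply: continuousB; last first.
    by apply: continuousM; [exact: cst_continuous|exact: continuous_dotv].
  (* A Lipschitz constant of [dotv y y] at [x] for [y] within distance [1]; the final [+ 1] keeps it
     positive when [n = 0]. *)
  pose k : R := n%:R * (1 + 2 * `|x|) + 1.
  have k0 : 0 < k by rewrite /k ltr_wpDl// mulr_ge0// addr_ge0// mulr_ge0.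
  suff : dotv y y @[y --> x] --> dotv x x by [].
  apply/(@cvgrPdist_le _ _ _ _ (nbhs_filter x)) => e e0; near=> y.
  have -> : dotv x x - dotv y y = - (dotv (y - x) (y - x) + 2 * dotv x (y - x)).
    by rewrite !(dotvBl, dotvBr) (dotvC y x); ring.
  rewrite normrN (le_trans (ler_normD _ _))// normrM [`|2|]ger0_norm//.
  have yx : `|y - x| <= 1.
    by near: y; apply: cvgr_distC_le.
  have yxe : `|y - x| <= e / k.
    by near: y; apply: cvgr_distC_le => //; exact: divr_gt0.
  apply: (@le_trans _ _ (k * `|y - x|)); last by rewrite mulrC -ler_pdivlMr.
  have d1 := norm_dotv_le (y - x) (y - x); have d2 := norm_dotv_le x (y - x).
  apply: (@le_trans _ _ (n%:R * (1 * `|y - x|) + 2 * (n%:R * (`|x| * `|y - x|)))).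
    by rewrite lerD ?ler_wpM2l// (le_trans d1)// ler_wpM2l// ler_wpM2r.
  rewrite -subr_ge0 (_ : _ - _ = `|y - x|)//.
  by rewrite /k; ring.
have [c Zc fc] := strongly_convex_argmin ltr01 Z0 clZ scf cf.
exists c => // y Zy; rewrite leNgt; apply/negP => D0.
set D := dotv _ _ in D0; pose q := dotv (y - c) (y - c).
have q0 : 0 <= q := dotv_ge0 _.
(* If [D > 0], moving from [c] towards [y] by the fraction [s] lowers [f] by [s * (2 * D - s * q)];
   this [s] is below [1] and satisfies [s * q < D], which contradicts minimality. *)
pose s := D / (q + D + 1).
have qD : 0 < q + D + 1 by lra.
have s01 : 0 < s < 1 by rewrite divr_gt0//= ltr_pdivrMr//; lra.
have := fc _ (cvZ _ _ Zy Zc s s01).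
have -> : f (s *: y + (1 - s) *: c) = f c - s * (2 * D - s * q).
  rewrite /f /D /q !(dotvBl, dotvBr, dotvDl, dotvDr, dotvZl, dotvZr) (dotvC y c).
  by ring.
suff : 0 < s * (2 * D - s * q) by lra.
rewrite mulr_gt0 ?(andP s01).1//.
have : s * q < D * 1.
  rewrite /s mulrAC -mulrA ltr_pM2l// ltr_pdivrMr//; lra.
by lra.
Unshelve. all: by end_near. Qed.

(** Fix [t], project [z t] to [c] and put [d = z t - c]. The function [s^r dotv d (z s - c)] starts
    at [0] and has derivative [(s^r)' dotv d (g s - c) <= 0]; at [s = t] this forces
    [dotv d d <= 0]. *)
Lemma average_in_closed_convex (R : realType) (n : nat) (Z : set 'cV[R]_n)
    (r : R) (g z : R -> 'cV[R]_n) : 0 < r -> closed Z ->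
  (forall x y, Z x -> Z y -> forall t : R, 0 < t < 1 ->
    Z (t *: x + (1 - t) *: y)) ->
  (forall t : R, 0 <= t -> Z (g t)) -> average r g z ->
  forall t : R, 0 <= t -> Z (z t).
Proof.
move=> r0 clZ cvZ Zg [cz z0 dz] t; rewrite le_eqVlt => /predU1P[<-|t0].
  by rewrite z0; exact: Zg.
have Z0 : Z !=set0 by exists (g 0); exact: Zg.
have [c Zc cP] := projection_exists (z t) Z0 clZ cvZ.
set d := z t - c in cP.
have := @le_increment R (fun s => dotv d (pospow r s *: (z s - c))) (cst 0)
  (fun s => dotv d ((r * (pospow r s / s)) *: (g s - c))) (cst 0) 0 t (ltW t0).
rewrite pospow0// scale0r !dotvZr (_ : dotv d 0 = 0); last first.
  by rewrite -(scale0r 0) dotvZr mul0r.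
rewrite !subr0 -/d => H.
suff : dotv d d <= 0.
  move=> dd; suff -> : z t = c by [].
  apply/eqP; rewrite -subr_eq0 -normr_eq0 -sqrf_eq0 eq_le sqr_ge0 andbT.
  exact: le_trans (sqr_norm_le_dotv _) dd.
rewrite -(pmulr_rle0 _ (pospow_gt0 r t0)); apply: H.
- move=> s; apply: continuous_comp; last exact: continuous_dotv.
  apply: cvgZ; first exact: continuous_pospow.
  by apply: cvgB; [exact: cz|exact: cvg_cst].
- by move=> s; exact: cvg_cst.
- move=> s /andP[s0 _]; apply: is_derive_dotv; apply: is_derive_pospow_average => //.
  have := is_deriveB (dz s s0) (is_derive_cst c s 1).
  by move/is_derive_eq; apply; rewrite subr0 opprB addrA subrK.
- move=> s /andP[s0 _]; rewrite dotvZr mulr_ge0_le0 ?cP//.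
    by rewrite mulr_ge0 ?divr_ge0 ?pospow_ge0 ?ltW.
  by apply: Zg; exact: ltW.
Qed.

(** * The Picard iteration *)

Record regular_system (R : realType) (n : nat) (L : R) (Z : set 'cV[R]_n)
    (N B Q : 'cV[R]_n -> 'cV[R]_n) : Prop := {
  reg_L : 1 <= L;
  reg_closed : closed Z;
  reg_convex : forall x y, Z x -> Z y -> forall t : R, 0 < t < 1 ->
    Z (t *: x + (1 - t) *: y);
  reg_in : forall w, Z (N w);
  reg_N : forall w w', `|N w - N w'| <= L * `|w - w'|;
  reg_B : forall z z', Z z -> Z z' -> `|B z - B z'| <= L * `|z - z'|;
  reg_Q : forall w w', `|Q w - Q w'| <= L * `|w - w'| }.

(* One step of the Picard iteration, from [w] to [W]; a pair [(z, w)] with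
   [picard_step r N B Q w0 z w w] solves the initial value problem. *)
Record picard_step (R : realType) (n : nat) (r : R)
    (N B Q : 'cV[R]_n -> 'cV[R]_n) (w0 : 'cV[R]_n)
    (z w W : R -> 'cV[R]_n) : Prop := {
  step_z : average r (N \o w) z;
  step_continuous : continuous W;
  step_init : W 0 = w0;
  step_derive : forall t : R, 0 < t ->
    is_derive t 1 W ((t / r) *: (Q (w t) - B (z t))) }.

(* The weight satisfies [weight' = 2 (L + L^2) (t / r) weight]; this makes the
   Picard step a contraction of ratio 1/2. *)
Definition weight (R : realType) (r L t : R) : R :=
  expR ((L + L ^+ 2) / r * t ^+ 2).

Lemma lipschitz_continuous (R : realType) (n : nat) (L : R)
    (f : 'cV[R]_n -> 'cV[R]_n) (A : set 'cV[R]_n) (g : R -> 'cV[R]_n) :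
  (forall x y, A x -> A y -> `|f x - f y| <= L * `|x - y|) ->
  (forall t, A (g t)) -> continuous g -> continuous (f \o g).
Proof.
move=> fL Ag cg t; pose k := `|L| + 1; have k0 : 0 < k by rewrite ltr_wpDl.
apply/cvgrPdist_le => e e0; near=> s => /=.
apply: le_trans (fL _ _ (Ag t) (Ag s)) _.
apply: (@le_trans _ _ (k * `|g t - g s|)).
  by rewrite ler_wpM2r// (le_trans (ler_norm _))// lerDl.
rewrite mulrC -ler_pdivlMr//; near: s.
by have /cvgrPdist_le := cg t; apply; exact: divr_gt0.
Unshelve. all: by end_near. Qed.

Lemma continuous_max0 (R : realType) (V : topologicalType) (g : R -> V) :
  continuous g -> continuous (fun t : R => g (Num.max 0 t)).
Proof.
move=> cg t; apply: (@continuous_comp R R V (fun t : R => Num.max 0 t) g).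
  by apply: continuous_max; [exact: cvg_cst|exact: cvg_id].
exact: cg.
Qed.

Lemma picard_z_in (R : realType) (n : nat) (r L : R) (Z : set 'cV[R]_n)
    (N B Q : 'cV[R]_n -> 'cV[R]_n) (z w : R -> 'cV[R]_n) :
  0 < r -> regular_system L Z N B Q -> average r (N \o w) z ->
  forall t : R, 0 <= t -> Z (z t).
Proof.
move=> r0 reg; apply: average_in_closed_convex => //.
- exact: reg_closed reg.
- exact: reg_convex reg.
- by move=> t _ /=; exact: (reg_in reg).
Qed.

Lemma picard_step_exists (R : realType) (n : nat) (r L : R) (Z : set 'cV[R]_n)
    (N B Q : 'cV[R]_n -> 'cV[R]_n) (w0 : 'cV[R]_n) (w : R -> 'cV[R]_n) :
  0 < r -> regular_system L Z N B Q -> continuous w ->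
  exists z W, picard_step r N B Q w0 z w W.
Proof.
move=> r0 reg cw.
have cN : continuous (N \o w).
  exact: (@lipschitz_continuous _ _ L N setT w (fun x y _ _ => reg_N reg x y)).
have cQ : continuous (Q \o w).
  exact: (@lipschitz_continuous _ _ L Q setT w (fun x y _ _ => reg_Q reg x y)).
have [z az] := average_exists r0 cN.
have zZ := picard_z_in r0 reg az.
have cz : continuous z by case: az.
(* Only at nonnegative times is [z] known to be in [Z], where [B] is Lipschitz; hence the truncation
   before integrating. *)
have cB : continuous (fun t : R => B (z (Num.max 0 t))).
  apply: (@lipschitz_continuous _ _ L B Z (fun t : R => z (Num.max 0 t))).
  - by move=> x y; exact: (reg_B reg).
  - by move=> t; apply: zZ; rewrite le_max lexx.
  - exact: continuous_max0.
have [|P [cP P0 dP]] := @primitive_cV_exists R n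
    (fun t : R => (t / r) *: (Q (w t) - B (z (Num.max 0 t)))).
  move=> t; apply: cvgZ; first by apply: cvgM; [exact: cvg_id|exact: cvg_cst].
  by apply: cvgB; [exact: cQ|exact: cB].
exists z, (fun t => w0 + P t); split=> //.
- by move=> t; apply: cvgD; [exact: cvg_cst|exact: cP].
- by rewrite P0 addr0.
move=> t t0; have := is_deriveD (is_derive_cst w0 t 1) (dP t t0).
by move/is_derive_eq; apply; rewrite add0r max_r// ltW.
Qed.

Lemma is_derive_weight (R : realType) (r L t : R) :
  is_derive t 1 (weight r L) (2 * ((L + L ^+ 2) * (t / r)) * weight r L t).
Proof.
have dsq : is_derive t 1 (fun s => (L + L ^+ 2) / r * s ^+ 2)
    ((L + L ^+ 2) / r * (2 * t)).
  have := is_deriveZ ((L + L ^+ 2) / r) (is_deriveX 2 (is_derive_id t (1 : R))).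
  move/is_derive_eq; apply; rewrite /GRing.scale/= expr1 mulr1.
  by rewrite mulr_natl.
have := is_derive1_comp (is_derive_expR _) dsq.
by move/is_derive_eq; apply; rewrite /weight; ring.
Qed.

Lemma continuous_weight (R : realType) (r L : R) : continuous (weight r L).
Proof.
move=> t; have [+ _] := is_derive_weight r L t.
by move=> /derivable1_diffP; exact: differentiable_continuous.
Qed.

Lemma weight_le (R : realType) (r L s t : R) : 0 < r -> 1 <= L ->
  0 <= s <= t -> weight r L s <= weight r L t.
Proof.
move=> r0 L1 /andP[s0 st]; rewrite /weight ler_expR ler_wpM2l//.
  by rewrite divr_ge0 ?(ltW r0)// addr_ge0 ?sqr_ge0//; lra.
by rewrite lerXn2r// nnegrE (le_trans s0).
Qed.

Lemma weight_ge1 (R : realType) (r L t : R) : 0 < r -> 1 <= L ->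
  1 <= weight r L t.
Proof.
move=> r0 L1; rewrite /weight -expR0 ler_expR mulr_ge0 ?sqr_ge0//.
by rewrite divr_ge0 ?(ltW r0)// addr_ge0 ?sqr_ge0//; lra.
Qed.

(** At time [s], [Q] contributes [L] and [B] contributes [L * L], since [z] inherits the bound on
    [w] with factor [L] and the weight is nondecreasing. The total [(s / r) (L + L^2) A weight] is
    exactly the derivative of [(A / 2) weight]. *)
Lemma picard_contraction (R : realType) (n : nat) (r L T A : R)
    (Z : set 'cV[R]_n) (N B Q : 'cV[R]_n -> 'cV[R]_n) (w0 : 'cV[R]_n)
    (z w W z' w' W' : R -> 'cV[R]_n) :
  0 < r -> regular_system L Z N B Q ->
  picard_step r N B Q w0 z w W -> picard_step r N B Q w0 z' w' W' ->
  (forall t : R, 0 <= t <= T -> `|w t - w' t| <= A * weight r L t) ->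
  forall t : R, 0 <= t <= T -> `|W t - W' t| <= A / 2 * weight r L t.
Proof.
move=> r0 reg [az cW W0 dW] [az' cW' W'0 dW'] wA t /andP[t0 tT].
have L1 := reg_L reg; have L0 : 0 <= L by lra.
have A0 : 0 <= A.
  have := wA t; rewrite t0 tT => /(_ isT) /(le_trans (normr_ge0 _)).
  by rewrite pmulr_lge0// (lt_le_trans ltr01)// weight_ge1.
suff : `|W t - W' t - (W 0 - W' 0)| <= A / 2 * weight r L t - A / 2 * weight r L 0.
  rewrite W0 W'0 subrr subr0 => /le_trans; apply.
  by rewrite gerBl// mulr_ge0//; [lra|rewrite (le_trans ler01)// weight_ge1].
apply: (@norm_increment R n (fun s => W s - W' s)
  (fun s => (s / r) *: (Q (w s) - B (z s)) - (s / r) *: (Q (w' s) - B (z' s)))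
  (fun s => A / 2 * weight r L s)
  (fun s => A / 2 * (2 * ((L + L ^+ 2) * (s / r)) * weight r L s))) => //.
- by move=> s; apply: cvgB; [exact: cW|exact: cW'].
- by move=> s; apply: cvgM; [exact: cvg_cst|exact: continuous_weight].
- by move=> s /andP[s0 _]; apply: is_deriveB; [exact: dW|exact: dW'].
- by move=> s _; have := is_deriveZ (A / 2) (is_derive_weight r L s).
move=> s /andP[s0 st]; have sr0 : 0 <= s / r by rewrite divr_ge0 ?ltW.
rewrite -scalerBr normrZ (ger0_norm sr0).
have sT : s <= T by lra.
have ws : `|w s - w' s| <= A * weight r L s by apply: wA; rewrite sT ltW.
have zs : `|z s - z' s| <= L * (A * weight r L s).
  apply: (average_close r0 az az' (T := s)); last by rewrite s0 lexx.
  move=> u /andP[u0 us] /=; apply: le_trans (reg_N reg _ _) _.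
  rewrite ler_wpM2l//; apply: (@le_trans _ _ (A * weight r L u)).
    by apply: wA; rewrite ltW//= (le_trans us).
  by rewrite ler_wpM2l// weight_le// (ltW u0).
have Zz := picard_z_in r0 reg az (ltW s0).
have Zz' := picard_z_in r0 reg az' (ltW s0).
have -> : A / 2 * (2 * ((L + L ^+ 2) * (s / r)) * weight r L s) =
  s / r * (L * (A * weight r L s) + L * (L * (A * weight r L s))) by field; rewrite gt_eqF.
rewrite ler_wpM2l//.
have -> : Q (w s) - B (z s) - (Q (w' s) - B (z' s)) =
  (Q (w s) - Q (w' s)) - (B (z s) - B (z' s)).
  by apply/matrixP => i j; rewrite !mxE; ring.
rewrite (le_trans (ler_normB _ _))// lerD//.
  by rewrite (le_trans (reg_Q reg _ _))// ler_wpM2l.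
by rewrite (le_trans (reg_B reg Zz Zz'))// ler_wpM2l.
Qed.

Lemma le0_geometric (R : realType) (x c : R) :
  (forall k, x <= c * 2^-1 ^+ k) -> x <= 0.
Proof.
move=> xc; apply: (@ler_cvg_to _ \oo _ R (cst x) (geometric c 2^-1) x 0).
- exact: cvg_cst.
- by apply: cvg_geometric; rewrite ger0_norm//; lra.
- by apply: nearW => k; exact: xc.
Qed.

Lemma picard_fixpoint_unique (R : realType) (n : nat) (r L : R)
    (Z : set 'cV[R]_n) (N B Q : 'cV[R]_n -> 'cV[R]_n) (w0 : 'cV[R]_n)
    (z w z' w' : R -> 'cV[R]_n) :
  0 < r -> regular_system L Z N B Q ->
  picard_step r N B Q w0 z w w -> picard_step r N B Q w0 z' w' w' ->
  forall t : R, 0 <= t -> z t = z' t /\ w t = w' t.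
Proof.
move=> r0 reg st st'.
have ww' (t : R) : 0 <= t -> w t = w' t.
  move=> t0; have [|A _ wA] := @EVT_max R (fun s => `|w s - w' s|) 0 t t0.
    apply: continuous_subspaceT => s; apply: cvg_norm.
    by apply: cvgB; [exact: (step_continuous st)|exact: (step_continuous st')].
  set a := `|w A - w' A| in wA.
  (* A fixed point is its own Picard step, so the contraction can be iterated on the same pair; it
     starts from the maximum [a] over the interval, as the weight is at least [1]. *)
  have wk k : forall s : R, 0 <= s <= t ->
      `|w s - w' s| <= a * 2^-1 ^+ k * weight r L s.
    elim: k => [s s0t|k IH].
      rewrite expr0 mulr1; apply: (@le_trans _ _ (a * 1)).
        by rewrite mulr1; apply: wA; rewrite in_itv.
      by rewrite ler_wpM2l ?normr_ge0// weight_ge1// (reg_L reg).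
    by rewrite exprSr mulrA; exact: picard_contraction r0 reg st st' IH.
  apply/eqP; rewrite -subr_eq0 -normr_le0.
  apply: (@le0_geometric _ _ (a * weight r L t)) => k.
  by rewrite mulrAC; apply: wk; rewrite t0 lexx.
move=> t t0; split; last exact: ww'.
move: t0; rewrite le_eqVlt => /predU1P[<-|t0].
  have [_ -> _] := step_z st; have [_ -> _] := step_z st'.
  by rewrite /= ww'.
apply/eqP; rewrite -subr_eq0 -normr_le0.
apply: (average_close r0 (step_z st) (step_z st') (T := t)); last by rewrite t0 lexx.
by move=> s /andP[s0 _]; rewrite /= ww' ?subrr ?normr0// ltW.
Qed.

(* Freezing [w] at [w0] makes [z] constant, so the first step is explicit. *)
Lemma picard_first_step (R : realType) (n : nat) (r L : R)
    (Z : set 'cV[R]_n) (N B Q : 'cV[R]_n -> 'cV[R]_n) (w0 : 'cV[R]_n)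
    (z W : R -> 'cV[R]_n) : 0 < r -> regular_system L Z N B Q ->
  picard_step r N B Q w0 z (cst w0) W ->
  forall t : R, 0 <= t -> `|W t - w0| <= `|Q w0 - B (N w0)| * weight r L t.
Proof.
move=> r0 reg [az cW W0 dW] t t0; have L1 := reg_L reg.
set C := `|_ - B _|.
(* The constant function is an average of the same data, so [average_close] applies with bound
   [0]. *)
have zE s : 0 < s -> z s = N w0.
  move=> s0; apply/eqP; rewrite -subr_eq0 -normr_le0.
  apply: (average_close r0 az (g' := cst (N w0)) (z' := cst (N w0)) (T := s)).
  - split=> [u|//|u _]; first exact: cvg_cst.
    by rewrite /= subrr scaler0; exact: is_derive_cst.
  - by move=> u _; rewrite /= subrr normr0.
  - by rewrite s0 lexx.
suff : `|W t - W 0| <= C * weight r L t - C * weight r L 0.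
  rewrite W0 => /le_trans; apply.
  by rewrite gerBl// mulr_ge0 ?normr_ge0// (le_trans ler01)// weight_ge1.
apply: (@norm_increment R n W (fun s => (s / r) *: (Q w0 - B (z s)))
  (fun s => C * weight r L s)
  (fun s => C * (2 * ((L + L ^+ 2) * (s / r)) * weight r L s))) => //.
- by move=> s; apply: cvgM; [exact: cvg_cst|exact: continuous_weight].
- by move=> s /andP[s0 _]; exact: dW.
- by move=> s _; have := is_deriveZ C (is_derive_weight r L s).
move=> s /andP[s0 st]; have sr0 : 0 <= s / r by rewrite divr_ge0 ?ltW.
rewrite zE// normrZ (ger0_norm sr0) mulrC ler_wpM2l ?normr_ge0//.
apply: (@le_trans _ _ (2 * (s / r))); first lra.
rewrite -mulrA ler_wpM2l//; apply: (@le_trans _ _ (1 * (s / r) * 1)).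
  by rewrite mul1r mulr1.
rewrite ler_pM ?mul1r ?weight_ge1// ler_peMl//.
by have := sqr_ge0 L; lra.
Qed.

Lemma picard_fixpoint_exists (R : realType) (n : nat) (r L : R)
    (Z : set 'cV[R]_n) (N B Q : 'cV[R]_n -> 'cV[R]_n) (w0 : 'cV[R]_n) :
  0 < r -> regular_system L Z N B Q ->
  exists z w, picard_step r N B Q w0 z w w.
Proof.
move=> r0 reg; have L1 := reg_L reg.
have /choice[Phi PhiP] : forall w : R -> 'cV[R]_n,
    exists zW : (R -> 'cV[R]_n) * (R -> 'cV[R]_n),
    continuous w -> picard_step r N B Q w0 zW.1 w zW.2.
  (* For a discontinuous [w] nothing is claimed and the pair is arbitrary; all iterates are
     continuous. *)
  move=> w; have [cw|ncw] := pselect (continuous w); last by exists (w, w).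
  by have [z [W zW]] := picard_step_exists w0 r0 reg cw; exists (z, W).
pose w_ k := iter k (fun w => (Phi w).2) (cst w0).
have cw_ k : continuous (w_ k).
  elim: k => [t|k IH]; first exact: cvg_cst.
  exact: step_continuous (PhiP _ IH).
have stepw k := PhiP _ (cw_ k).
set C := `|Q w0 - B (N w0)|.
have wt0 (t : R) : 0 < weight r L t by rewrite (lt_le_trans ltr01)// weight_ge1.
have dw_ k (t : R) : 0 <= t ->
    `|w_ k.+1 t - w_ k t| <= C * 2^-1 ^+ k * weight r L t.
  move=> t0; suff H : forall s : R, 0 <= s <= t ->
      `|w_ k.+1 s - w_ k s| <= C * 2^-1 ^+ k * weight r L s.
    by apply: H; rewrite t0 lexx.
  elim: k => [s /andP[s0 _]|k IH].
    by rewrite expr0 mulr1; exact: picard_first_step r0 reg (stepw 0) _ s0.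
  rewrite exprSr mulrA.
  exact: (picard_contraction r0 reg (stepw k.+1) (stepw k) IH).
(* The factor [2 * (1 - 2^-1 ^+ j)] is the partial geometric sum over [i < j]; keeping it exact lets
   the induction close. *)
have dwkj k j (t : R) : 0 <= t ->
    `|w_ (k + j)%N t - w_ k t| <=
      2 * C * 2^-1 ^+ k * weight r L t * (1 - 2^-1 ^+ j).
  move=> t0; elim: j => [|j IH].
    by rewrite addn0 subrr normr0 expr0 subrr mulr0.
  rewrite addnS; apply: le_trans (ler_distD (w_ (k + j)%N t) _ _) _.
  apply: le_trans (lerD (dw_ _ _ t0) IH) _.
  by rewrite exprD exprS; lra.
have C0 : 0 <= C by exact: normr_ge0.
have dwk k l (t : R) : 0 <= t -> (k <= l)%N ->
    `|w_ l t - w_ k t| <= 2 * C * weight r L t * 2^-1 ^+ k.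
  move=> t0 kl; rewrite -(subnKC kl); apply: le_trans (dwkj _ _ _ t0) _.
  rewrite [leRHS]mulrAC -[leRHS]mulr1; apply: ler_wpM2l.
    by rewrite !mulr_ge0 ?exprn_ge0// ltW.
  by rewrite gerBl exprn_ge0.
have half_small (c e : R) : 0 < e -> \forall k \near \oo, c * 2^-1 ^+ k <= e.
  move=> e0; have : geometric c 2^-1 @ \oo --> (0 : R).
    by apply: cvg_geometric; rewrite ger0_norm//; lra.
  move=> /cvgrPdist_le/(_ e e0); apply: filterS => k.
  by rewrite sub0r normrN => /(le_trans (ler_norm _)).
have /choice[w wP] : forall t : R, exists v : 'cV[R]_n,
    w_ k (Num.max 0 t) @[k --> \oo] --> v.
  move=> t; have t0 : 0 <= Num.max 0 t by rewrite le_max lexx.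
  set t' := Num.max 0 t in t0 *.
  apply/cvg_ex; apply/cauchy_cvgP/cauchy_exP => e e0.
  have e2 : 0 < e / 2 by rewrite divr_gt0.
  have [K _ Kh] := half_small (2 * C * weight r L t') _ e2.
  exists (w_ K t'); exists K => // l /= Kl.
  rewrite -ball_normE/= distrC (le_lt_trans (dwk _ _ _ t0 Kl))//.
  by rewrite (le_lt_trans (Kh K (leqnn _)))//; lra.
have wmax (t : R) : 0 <= t -> w_ k t @[k --> \oo] --> w t.
  by move=> t0; have := wP t; rewrite max_r.
have wk k (t : R) : 0 <= t ->
    `|w t - w_ k t| <= 2 * C * weight r L t * 2^-1 ^+ k.
  move=> t0.
  have H : `|w_ l t - w_ k t| @[l --> \oo] --> `|w t - w_ k t|.
    by apply: cvg_norm; apply: cvgB; [exact: wmax|exact: cvg_cst].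
  apply: (ler_cvg_to H (cvg_cst (2 * C * weight r L t * 2^-1 ^+ k))).
  by exists k => // l /= kl; exact: dwk.
have wE (t : R) : w (Num.max 0 t) = w t.
  have : w_ k (Num.max 0 t) @[k --> \oo] --> w (Num.max 0 t).
    by apply: wmax; rewrite le_max lexx.
  by move=> H; exact: (cvg_unique _ H (wP t)).
have cw : continuous w.
  move=> t; apply/cvgrPdist_le => e e0.
  have e3 : 0 < e / 3 by rewrite divr_gt0.
  (* Near [t] all truncated times stay below [T], so [weight r L T] makes the convergence uniform
     there. *)
  pose T := Num.max 0 t + 1.
  have [k _ kh] := half_small (2 * C * weight r L T) _ e3.
  have {}kh := kh k (leqnn _).
  have wT (s : R) : s <= T -> `|w s - w_ k (Num.max 0 s)| <= e / 3.
    move=> sT; rewrite -(wE s); apply: le_trans (wk k _ _) _.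
      by rewrite le_max lexx.
    apply: le_trans _ kh; rewrite ler_wpM2r ?exprn_ge0// ler_wpM2l ?mulr_ge0//.
    rewrite weight_le// le_max lexx/= ge_max sT andbT /T addr_ge0//.
    by rewrite le_max lexx.
  have ckm : {for t, continuous (fun s : R => w_ k (Num.max 0 s))}.
    exact: continuous_max0.
  have /cvgrPdist_le/(_ _ e3) ckt := ckm.
  near=> s.
  have -> : w t - w s = (w t - w_ k (Num.max 0 t)) +
      ((w_ k (Num.max 0 t) - w_ k (Num.max 0 s)) - (w s - w_ k (Num.max 0 s))).
    by apply/matrixP => i j; rewrite !mxE; ring.
  apply: le_trans (ler_normD _ _) _.
  have -> : e = e / 3 + (e / 3 + e / 3) by field.
  apply: lerD.
    by apply: wT; rewrite /T (@le_trans _ _ (Num.max 0 t)) ?lerDl// le_max lexx orbT.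
  apply: le_trans (ler_normB _ _) _; apply: lerD; first by near: s; exact: ckt.
  apply: wT; rewrite /T; apply: (@le_trans _ _ (t + 1)).
    by apply: ltW; near: s; apply: lt_nbhsl; rewrite ltrDl.
  by rewrite lerD2r le_max lexx orbT.
have stepz := PhiP _ cw; set z := (Phi w).1 in stepz; set W := (Phi w).2 in stepz.
(* [W] is the Picard step from the limit [w]. Both [W] and [w] are within a multiple of [2^-1 ^+ k]
   of the iterate [w_ k.+1], for every [k]. *)
have WE (t : R) : 0 <= t -> W t = w t.
  move=> t0; apply/eqP; rewrite -subr_eq0 -normr_le0.
  apply: (@le0_geometric _ _ (2 * C * weight r L t)) => k.
  rewrite (_ : W t - w t = (W t - w_ k.+1 t) - (w t - w_ k.+1 t)); last first.
    by apply/matrixP => i j; rewrite !mxE; ring.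
  have h1 := wk k.+1 t t0.
  have h2 : `|W t - w_ k.+1 t| <= 2 * C * 2^-1 ^+ k / 2 * weight r L t.
    apply: (picard_contraction r0 reg stepz (stepw k) (T := t)).
      by move=> s /andP[s0 _]; rewrite mulrAC; exact: wk.
    by rewrite t0 lexx.
  apply: le_trans (ler_normB _ _) _; rewrite exprS in h1; lra.
exists z, w; split=> //.
- exact: step_z stepz.
- by rewrite -WE// (step_init stepz).
move=> t t0; apply: near_eq_is_derive (step_derive stepz t0).
near=> s; apply: WE; apply: ltW; near: s; exact: lt_nbhsr.
Unshelve. all: by end_near. Qed.

(** * From the saddle-point data to a regular system *)

Lemma lipschitz_bound (R : realType) (n : nat) (X : set 'cV[R]_n)
    (f : 'cV[R]_n -> 'cV[R]_n) : [lipschitz f x | x in X] ->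
  exists2 M0, 0 <= M0 & forall M, M0 <= M ->
    forall x y, X x -> X y -> `|f x - f y| <= M * `|x - y|.
Proof.
(* The Lipschitz predicate holds for all constants strictly beyond some real; stating the bound for
   every large [M] allows a common constant later. *)
move=> [M0 [_ fM0]]; exists (`|M0| + 1) => [|M M0M x y Xx Xy].
  by rewrite addr_ge0.
have fM : M.-lipschitz_X f.
  by apply: fM0; rewrite (le_lt_trans (ler_norm _))// (lt_le_trans _ M0M)// ltrDl.
exact: (fM (x, y)).
Qed.

Lemma usubmx_norm_le (R : realType) (p q : nat) (z : 'cV[R]_(p + q)) :
  `|usubmx z| <= `|z|.
Proof.
apply: mx_norm_le; first exact: normr_ge0.
by move=> i j; rewrite mxE; exact: mx_coord_norm.
Qed.

Lemma dsubmx_norm_le (R : realType) (p q : nat) (z : 'cV[R]_(p + q)) :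
  `|dsubmx z| <= `|z|.
Proof.
apply: mx_norm_le; first exact: normr_ge0.
by move=> i j; rewrite mxE; exact: mx_coord_norm.
Qed.

Lemma mulmx_norm_le (R : realType) (m n : nat) (A : 'M[R]_(m, n))
    (x : 'cV[R]_n) : `|A *m x| <= n%:R * `|A| * `|x|.
Proof.
apply: mx_norm_le => [|i j]; first by rewrite !mulr_ge0.
rewrite mxE (le_trans (ler_norm_sum _ _ _))//.
rewrite (@le_trans _ _ (\sum_(k < n) `|A| * `|x|))//.
  by apply: ler_sum => k _; rewrite normrM ler_pM// mx_coord_norm.
by rewrite sumr_const card_ord -mulrA mulr_natl.
Qed.

Lemma continuous_usubmx (R : realType) (p q : nat) :
  continuous (usubmx : 'cV[R]_(p + q) -> 'cV[R]_p).
Proof.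
move=> z; apply/(cvg_mxP (nbhs_filter z)) => i j.
by under eq_fun do rewrite mxE; rewrite mxE; exact: coord_continuous.
Qed.

Lemma continuous_dsubmx (R : realType) (p q : nat) :
  continuous (dsubmx : 'cV[R]_(p + q) -> 'cV[R]_q).
Proof.
move=> z; apply/(cvg_mxP (nbhs_filter z)) => i j.
by under eq_fun do rewrite mxE; rewrite mxE; exact: coord_continuous.
Qed.

Definition stack_set (R : realType) (p q : nat) (X : set 'cV[R]_p)
    (Y : set 'cV[R]_q) : set 'cV[R]_(p + q) :=
  [set z | X (usubmx z) /\ Y (dsubmx z)].

Lemma stack_lipschitz (R : realType) (p q : nat) (M : R)
    (X : set 'cV[R]_p) (Y : set 'cV[R]_q)
    (f : 'cV[R]_p -> 'cV[R]_p) (g : 'cV[R]_q -> 'cV[R]_q) : 0 <= M ->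
  (forall x y, X x -> X y -> `|f x - f y| <= M * `|x - y|) ->
  (forall x y, Y x -> Y y -> `|g x - g y| <= M * `|x - y|) ->
  forall z z', stack_set X Y z -> stack_set X Y z' ->
    `|stack f g z - stack f g z'| <= M * `|z - z'|.
Proof.
move=> M0 fM gM z z' [Xz Yz] [Xz' Yz']; rewrite /stack opp_col_mx add_col_mx.
apply: mx_norm_le => [|i j]; first by rewrite mulr_ge0.
rewrite mxE; case: splitP => k _; apply: le_trans (mx_coord_norm _ _ _) _.
  apply: le_trans (fM _ _ Xz Xz') _; rewrite ler_wpM2l// -linearB.
  exact: usubmx_norm_le.
apply: le_trans (gM _ _ Yz Yz') _; rewrite ler_wpM2l// -linearB.
exact: dsubmx_norm_le.
Qed.

Lemma convex_set_segment (R : realType) (n : nat) (X : set 'cV[R]_n) :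
  convex_set X -> forall x y, X x -> X y -> forall t : R, 0 < t < 1 ->
  X (t *: x + (1 - t) *: y).
Proof.
move=> cX x y Xx Xy t /andP[t0 t1].
have := cX x y (Itv01 (ltW t0) (ltW t1)).
by rewrite !inE; exact.
Qed.

(** This is the shape of [Q], with [A] the skew coupling matrix and [P] the gradient of the mirror
    maps. [P] is Lipschitz only on [Z], which suffices because [N] takes its values there. *)
Lemma lipschitz_affine_comp (R : realType) (n : nat) (M : R)
    (Z : set 'cV[R]_n) (A : 'M[R]_n) (N P : 'cV[R]_n -> 'cV[R]_n) : 0 <= M ->
  (forall w, Z (N w)) ->
  (forall w w', `|N w - N w'| <= M * `|w - w'|) ->
  (forall z z', Z z -> Z z' -> `|P z - P z'| <= M * `|z - z'|) ->
  forall w w', `|(- (A *m N w) + P (N w) - w) - (- (A *m N w') + P (N w') - w')|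
    <= (n%:R * `|A| * M + M * M + 1) * `|w - w'|.
Proof.
move=> M0 NZ lN lP w w'.
have -> : - (A *m N w) + P (N w) - w - (- (A *m N w') + P (N w') - w') =
    - (A *m (N w - N w')) + (P (N w) - P (N w')) - (w - w').
  rewrite mulmxBr; move: (A *m _) (A *m _) (P _) (P _) => a a' b b'.
  by apply/matrixP => i j; rewrite !mxE; ring.
rewrite !mulrDl mul1r (le_trans (ler_normB _ _))// lerD//.
rewrite (le_trans (ler_normD _ _))// lerD//.
  by rewrite normrN (le_trans (mulmx_norm_le _ _))// -[leRHS]mulrA ler_wpM2l.
by rewrite (le_trans (lP _ _ (NZ w) (NZ w')))// -[leRHS]mulrA ler_wpM2l.
Qed.

Lemma mirror_system_regular (R : realType) (p q : nat) (H : 'M[R]_(p, q))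
    (X : set 'cV[R]_p) (Y : set 'cV[R]_q)
    (F : 'cV[R]_p -> R) (G : 'cV[R]_q -> R)
    (psi : 'cV[R]_p -> \bar R) (phi : 'cV[R]_q -> \bar R)
    (psi_s : 'cV[R]_p -> R) (phi_s : 'cV[R]_q -> R) :
  assumptionA H X Y F G -> assumptionB X Y psi phi psi_s phi_s ->
  let N := stack (grad_conj psi) (grad_conj phi) in
  exists L, regular_system L (stack_set X Y) N (stack (grad F) (grad G))
    (fun w => - (Htilde H *m N w) + stack (grad psi_s) (grad phi_s) (N w) - w).
Proof.
move=> aA [mpsi mphi] N; have [_ clX cvX] := A_X aA; have [_ clY cvY] := A_Y aA.
have NZ w : stack_set X Y (N w).
  rewrite /stack_set/= col_mxKu col_mxKd; split.
    exact: grad_conj_in_dom clX mpsi _.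
  exact: grad_conj_in_dom clY mphi _.
have [_ /lipschitz_bound[M1 M1_ge0 lipF]] := A_F aA.
have [_ /lipschitz_bound[M2 M2_ge0 lipG]] := A_G aA.
have [M3 M3_ge0 lippsi] := lipschitz_bound (mirror_lipschitz mpsi).
have [M4 M4_ge0 lipphi] := lipschitz_bound (mirror_lipschitz mphi).
have [M5 M5_ge0 lippsic] := lipschitz_bound (mirror_conj_lipschitz mpsi).
have [M6 M6_ge0 lipphic] := lipschitz_bound (mirror_conj_lipschitz mphi).
have [M [M0 M1M M2M M3M [M4M M5M M6M]]] : exists M : R, [/\ 0 <= M, M1 <= M,
    M2 <= M, M3 <= M & [/\ M4 <= M, M5 <= M & M6 <= M]].
  by exists (M1 + M2 + M3 + M4 + M5 + M6); split; [lra..|split; lra].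
have lipB := stack_lipschitz M0 (lipF _ M1M) (lipG _ M2M).
have lippi := stack_lipschitz M0 (lippsi _ M3M) (lipphi _ M4M).
have lipN w w' : `|N w - N w'| <= M * `|w - w'|.
  exact: (stack_lipschitz M0 (lippsic _ M5M) (lipphic _ M6M)).
have lipQ := lipschitz_affine_comp (Htilde H) M0 NZ lipN lippi.
have KM0 : 0 <= (p + q)%:R * `|Htilde H| * M by rewrite !mulr_ge0.
have MM0 : 0 <= M * M by rewrite mulr_ge0.
(* The constant of [Q], plus [M] so that it also dominates the constants of [N] and [B]; the summand
   [1] gives [1 <= L]. *)
exists ((p + q)%:R * `|Htilde H| * M + M * M + M + 1).
split=> //.
- by lra.
- apply: closedI.
    by apply: closed_comp clX => z _; exact: continuous_usubmx.
  by apply: closed_comp clY => z _; exact: continuous_dsubmx.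
- move=> x y [Xx Yx] [Xy Yy] t t01; split; rewrite linearD !linearZ/=.
    exact: convex_set_segment.
  exact: convex_set_segment.
- move=> w w'; apply: le_trans (lipN w w') _; rewrite ler_wpM2r//; lra.
- move=> z z' Zz Zz'; apply: le_trans (lipB _ _ Zz Zz') _.
  by rewrite ler_wpM2r//; lra.
move=> w w'; apply: le_trans (lipQ w w') _; rewrite ler_wpM2r//; lra.
Qed.

(** * Equivalence between solutions and fixed points of the Picard step *)

Lemma within_continuous_max0 (R : realType) (V : topologicalType) (f : R -> V) :
  {within `[0, +oo[, continuous f} -> continuous (fun t : R => f (Num.max 0 t)).
Proof.
move=> /subspace_continuousP cf t.
have m0 (s : R) : `[0, +oo[%classic (Num.max 0 s).
  by rewrite /= in_itv/= andbT le_max lexx.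
apply: (@cvg_trans _ (f @ within `[0, +oo[ (nbhs (Num.max 0 t)))); last exact: cf.
move=> A fA.
have cm : {for t, continuous (fun s : R => Num.max 0 s)}.
  by apply: continuous_max; [exact: cvg_cst|exact: cvg_id].
have fmA : \forall s \near t, `[0, +oo[%classic (Num.max 0 s) ->
  A (f (Num.max 0 s)) := cm _ fA.
suff : \forall s \near t, A (f (Num.max 0 s)) by [].
by near=> s; have : `[0, +oo[%classic (Num.max 0 s) -> A (f (Num.max 0 s));
  [near: s|apply; exact: m0].
Unshelve. all: by end_near.
Qed.

(** A solution is constrained at nonnegative times only, a Picard step must be continuous on the
    line; truncation bridges the two and is the identity near any [t > 0], so derivatives survive.
    The first equation removes [z'] from the second. *)
Lemma picard_step_of_solution (R : realType) (p q : nat) (r : R)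
    (H : 'M[R]_(p, q)) (B P N : 'cV[R]_(p + q) -> 'cV[R]_(p + q))
    (z0 w0 : 'cV[R]_(p + q)) (z w : R -> 'cV[R]_(p + q)) :
  0 < r -> z0 = N w0 -> solution r H B P N z0 w0 z w ->
  picard_step r N B (fun w => - (Htilde H *m N w) + P (N w) - w) w0
    (fun t => z (Num.max 0 t)) (fun t => w (Num.max 0 t))
    (fun t => w (Num.max 0 t)).
Proof.
move=> r0 z0E [cz cw dzw zE wE zi wi].
have near_max (f : R -> 'cV[R]_(p + q)) (D : 'cV[R]_(p + q)) (t : R) : 0 < t ->
    is_derive t 1 f D -> is_derive t 1 (fun s : R => f (Num.max 0 s)) D.
  move=> t0; apply: near_eq_is_derive; near=> s; rewrite max_r//.
  by apply: ltW; near: s; exact: lt_nbhsr.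
have zNw (t : R) : 0 < t -> z t + (t / r) *: derive1 z t = N (w t).
  move=> t0; rewrite zE// scalerA mulrA divfK ?gt_eqF// divff ?gt_eqF//.
  by rewrite scale1r addrC subrK.
split.
- split; first exact: within_continuous_max0.
    by rewrite /= maxxx zi wi.
  move=> t t0; apply: near_max => //=; rewrite max_r ?ltW// -zE//.
  by have [dz _] := dzw t t0; rewrite derive1E; exact: derivableP.
- exact: within_continuous_max0.
- by rewrite maxxx.
move=> t t0; apply: near_max => //=; rewrite max_r ?ltW//.
have [_ dw] := dzw t t0.
suff -> : (t / r) *: (- (Htilde H *m N (w t)) + P (N (w t)) - w t - B (z t)) =
  derive1 w t by rewrite derive1E; exact: derivableP.
rewrite wE// zNw//; congr (_ *: _).
by rewrite addrC !addrA.
Unshelve. all: by end_near. Qed.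

Lemma solution_of_picard_step (R : realType) (p q : nat) (r : R)
    (H : 'M[R]_(p, q)) (B P N : 'cV[R]_(p + q) -> 'cV[R]_(p + q))
    (z0 w0 : 'cV[R]_(p + q)) (z w : R -> 'cV[R]_(p + q)) :
  0 < r -> z0 = N w0 ->
  picard_step r N B (fun w => - (Htilde H *m N w) + P (N w) - w) w0 z w w ->
  solution r H B P N z0 w0 z w.
Proof.
move=> r0 z0E [[cz zi dz] cw wi dw].
have zE (t : R) : 0 < t -> derive1 z t = (r / t) *: (N (w t) - z t).
  by move=> t0; rewrite derive1E; have [_ ->] := dz t t0.
split=> //.
- exact: continuous_subspaceT.
- exact: continuous_subspaceT.
- by move=> t t0; split; [have [] := dz t t0|have [] := dw t t0].
- move=> t t0; have -> : z t + (t / r) *: derive1 z t = N (w t).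
    rewrite zE// scalerA mulrA divfK ?gt_eqF// divff ?gt_eqF//.
    by rewrite scale1r addrC subrK.
  rewrite derive1E; have [_ ->] := dw t t0; congr (_ *: _).
  by rewrite [LHS]addrC !addrA.
- by rewrite zi/= wi.
Qed.

Theorem theorem1 (R : realType) (p q : nat) (r : R) (H : 'M[R]_(p, q))
    (X : set 'cV[R]_p) (Y : set 'cV[R]_q)
    (F : 'cV[R]_p -> R) (G : 'cV[R]_q -> R)
    (psi : 'cV[R]_p -> \bar R) (phi : 'cV[R]_q -> \bar R)
    (psi_s : 'cV[R]_p -> R) (phi_s : 'cV[R]_q -> R)
    (z0 w0 : 'cV[R]_(p + q)) :
  let gradR := stack (grad F) (grad G) in
  let gradpi := stack (grad psi_s) (grad phi_s) in
  let gradpi_conj := stack (grad_conj psi) (grad_conj phi) in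
  0 < r ->
  assumptionA H X Y F G ->
  assumptionB X Y psi phi psi_s phi_s ->
  z0 = gradpi_conj w0 ->
  w0 = gradpi z0 ->
  exists z w : R -> 'cV[R]_(p + q),
    solution r H gradR gradpi gradpi_conj z0 w0 z w /\
    forall z' w' : R -> 'cV[R]_(p + q),
      solution r H gradR gradpi gradpi_conj z0 w0 z' w' ->
      forall t : R, 0 <= t -> z' t = z t /\ w' t = w t.
Proof.
move=> gradR gradpi gradpi_conj r0 aA aB z0E _.
have [L reg] := mirror_system_regular aA aB.
have [z [w zw]] := picard_fixpoint_exists w0 r0 reg.
exists z, w; split; first exact: solution_of_picard_step.
move=> z' w' /(picard_step_of_solution r0 z0E) zw' t t0.
(* Uniqueness holds for the truncation of the given solution, which agrees with it at [t >= 0]. *)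
by have := picard_fixpoint_unique r0 reg zw' zw t0; rewrite max_r.
Qed.
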